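(* Let $p\in[1,\infty)$. Then for every $f\in \bigcup_{0<s<1}{\rm B}_{s,p}^\kappa(\mathbb{R}^n)$, $$\lim_{s\to0^+}s\,{\rm N}^\kappa_{s,p}(f)^p=\frac{4}{p}\|f\|_{{\rm L}^p(\mu_\kappa)}^p.$$
   Context: Dunkl setting on $\mathbb{R}^n$ (standard inner product $\langle\cdot,\cdot\rangle$, norm $|\cdot|$). For $\alpha\neq0$, $r_\alpha x=x-2\frac{\langle\alpha,x\rangle}{|\alpha|^2}\alpha$. A root system $\mathcal{R}$ is a finite nonempty subset of $\mathbb{R}^n\setminus\{0\}$ with $\mathcal{R}\cap\alpha\mathbb{R}=\{\pm\alpha\}$ and $r_\alpha(\mathcal{R})=\mathcal{R}$ for all $\alpha\in\mathcal{R}$, normalized so that $|\alpha|=\sqrt2$; $G$ is the finite reflection group generated by $\{r_\alpha\}$; $\mathcal{R}_+$ is a positive subsystem; $\kappa:\mathcal{R}\to[0,\infty)$ is a $G$-invariant multiplicity function. The Dunkl Laplacian is $\Delta_\kappa f(x)=\Delta f(x)+2\sum_{\alpha\in\mathcal{R}_+}\kappa(\alpha)\big(\frac{\langle\alpha,\nabla f(x)\rangle}{\langle\alpha,x\rangle}-\frac{f(x)-f(r_\alpha x)}{\langle\alpha,x\rangle^2}\big)$. Let $w_\kappa(x)=\prod_{\alpha\in\mathcal{R}_+}|\langle\alpha,x\rangle|^{2\kappa(\alpha)}$, $\mu_\kappa=w_\kappa\,dx$, and ${\rm L}^p(\mu_\kappa)$ the usual Lebesgue space. $(P^\kappa_t)_{t\ge0}$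 is the Dunkl heat semigroup generated by $\Delta_\kappa$ (self-adjoint on ${\rm L}^2(\mu_\kappa)$), given by $P_t^\kappa f(x)=\int f(y)p_t^\kappa(x,y)\,\mu_\kappa(dy)$ with the (positive, smooth, symmetric, conservative) Dunkl heat kernel $p_t^\kappa$. For $p\in[1,\infty)$, $s>0$, the Besov seminorm is $${\rm N}^\kappa_{s,p}(f)=\Big(\int_0^\infty t^{-(1+\frac{sp}{2})}\int_{\mathbb{R}^n}P_t^\kappa(|f-f(x)|^p)(x)\,\mu_\kappa(dx)\,dt\Big)^{1/p},$$ where $P_t^\kappa(|f-f(x)|^p)(x)=\int |f(y)-f(x)|^p p_t^\kappa(x,y)\mu_\kappa(dy)$, and ${\rm B}^\kappa_{s,p}(\mathbb{R}^n)=\{f\in{\rm L}^p(\mu_\kappa):{\rm N}^\kappa_{s,p}(f)<\infty\}$. *)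

(* Defs.v *)
(* R^n is modelled as n.-tuple R (which carries the
   product (= Borel) sigma-algebra in MathComp-Analysis). *)
From HB Require Import structures.
From mathcomp Require Import all_boot all_order all_algebra.
From mathcomp Require Import all_classical all_reals all_analysis.

Set Implicit Arguments.
Unset Strict Implicit.
Unset Printing Implicit Defensive.

Import Order.TTheory GRing.Theory Num.Theory.
Import numFieldNormedType.Exports.
Local Open Scope classical_set_scope.
Local Open Scope ring_scope.

Definition vadd {R : realType} {n : nat} (x y : n.-tuple R) : n.-tuple R :=
  [tuple tnth x i + tnth y i | i < n].
Definition vscale {R : realType} {n : nat} (c : R) (x : n.-tuple R) : n.-tuple R :=
  [tuple c * tnth x i | i < n].
Definition vdot {R : realType} {n : nat} (x y : n.-tuple R) : R :=
  \sum_(i < n) tnth x i * tnth y i.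
Definition vnorm2 {R : realType} {n : nat} (x : n.-tuple R) : R := vdot x x.
Definition vzero {R : realType} {n : nat} : n.-tuple R := [tuple 0 | i < n].
Definition ebasis {R : realType} {n : nat} (i : 'I_n) : n.-tuple R :=
  [tuple (j == i)%:R | j < n].

Definition refl {R : realType} {n : nat} (a x : n.-tuple R) : n.-tuple R :=
  vadd x (vscale (- (2 * vdot a x / vnorm2 a)) a).

Definition root_system {R : realType} {n : nat} (rs : seq (n.-tuple R)) : Prop :=
  [/\ rs <> [::] /\ uniq rs,
      (forall a, a \in rs -> a <> vzero),
      (forall a c, a \in rs -> (vscale c a \in rs <-> (c = 1 \/ c = -1))),
      (forall a b, a \in rs -> b \in rs -> refl a b \in rs)
    & (forall a, a \in rs -> vnorm2 a = 2)].

Definition regular_vector {R : realType} {n : nat} (rs : seq (n.-tuple R))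
    (beta : n.-tuple R) : Prop :=
  forall a, a \in rs -> vdot beta a != 0.

Definition pos_roots {R : realType} {n : nat} (rs : seq (n.-tuple R))
    (beta : n.-tuple R) : seq (n.-tuple R) :=
  [seq a <- rs | 0 < vdot beta a].

(* action of the element r_{g_1} o ... o r_{g_k} of the reflection group G *)
Definition grp_act {R : realType} {n : nat} (gs : seq (n.-tuple R))
    (x : n.-tuple R) : n.-tuple R :=
  foldr refl x gs.

Definition multiplicity {R : realType} {n : nat} (rs : seq (n.-tuple R))
    (kappa : n.-tuple R -> R) : Prop :=
  (forall a, a \in rs -> 0 <= kappa a) /\
  (forall gs a, all (fun g => g \in rs) gs -> a \in rs ->
     kappa (grp_act gs a) = kappa a).

(* integral of a nonnegative function w.r.t. Lebesgue measure on R^n,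
   computed as an iterated integral (Tonelli) *)
Fixpoint leb_int {R : realType} (n : nat) :
    (n.-tuple R -> \bar R) -> \bar R :=
  match n return (n.-tuple R -> \bar R) -> \bar R with
  | 0 => fun g => g [tuple]
  | m.+1 => fun g =>
      (\int[@lebesgue_measure R]_x leb_int (fun t : m.-tuple R => g [tuple of x :: t]))%E
  end.

Definition wk {R : realType} {n : nat} (rs : seq (n.-tuple R)) (beta : n.-tuple R)
    (kappa : n.-tuple R -> R) (x : n.-tuple R) : R :=
  \prod_(a <- pos_roots rs beta) (`|vdot a x| `^ (2 * kappa a)).

Definition muk_int {R : realType} {n : nat} (rs : seq (n.-tuple R))
    (beta : n.-tuple R) (kappa : n.-tuple R -> R)
    (g : n.-tuple R -> \bar R) : \bar R :=
  leb_int (fun x => ((wk rs beta kappa x)%:E * g x)%E).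

Definition muk_sint {R : realType} {n : nat} (rs : seq (n.-tuple R))
    (beta : n.-tuple R) (kappa : n.-tuple R -> R) (g : n.-tuple R -> R) : \bar R :=
  (muk_int rs beta kappa (fun x => (Num.max (g x) 0)%:E)
   - muk_int rs beta kappa (fun x => (Num.max (- g x) 0)%:E))%E.

Definition in_Lp {R : realType} {n : nat} (rs : seq (n.-tuple R))
    (beta : n.-tuple R) (kappa : n.-tuple R -> R) (p : R)
    (f : n.-tuple R -> R) : Prop :=
  measurable_fun setT f /\
  (muk_int rs beta kappa (fun x => (`|f x| `^ p)%:E) < +oo)%E.

Definition pd {R : realType} {n : nat} (i : 'I_n) (f : n.-tuple R -> R)
    (x : n.-tuple R) : R :=
  derive1 (fun h : R => f (vadd x (vscale h (ebasis i)))) 0.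

Fixpoint iter_pd {R : realType} {n : nat} (ds : seq 'I_n) (f : n.-tuple R -> R) :
    n.-tuple R -> R :=
  match ds with
  | [::] => f
  | i :: ds' => pd i (iter_pd ds' f)
  end.

Definition smooth {R : realType} {n : nat} (f : n.-tuple R -> R) : Prop :=
  forall (ds : seq 'I_n) (i : 'I_n) (x : n.-tuple R),
    derivable (fun h : R => iter_pd ds f (vadd x (vscale h (ebasis i)))) 0 1.

Definition schwartz {R : realType} {n : nat} (f : n.-tuple R -> R) : Prop :=
  smooth f /\
  forall (ds : seq 'I_n) (k : nat), exists C : R, forall x,
    (1 + vnorm2 x) ^+ k * `|iter_pd ds f x| <= C.

Definition laplacian {R : realType} {n : nat} (f : n.-tuple R -> R)
    (x : n.-tuple R) : R :=
  \sum_(i < n) pd i (pd i f) x.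

Definition dunkl_laplacian {R : realType} {n : nat} (rs : seq (n.-tuple R))
    (beta : n.-tuple R) (kappa : n.-tuple R -> R) (f : n.-tuple R -> R)
    (x : n.-tuple R) : R :=
  laplacian f x +
  2 * \sum_(a <- pos_roots rs beta)
        kappa a * ((\sum_(i < n) tnth a i * pd i f x) / vdot a x
                   - (f x - f (refl a x)) / (vdot a x) ^+ 2).

Definition heat_op {R : realType} {n : nat} (rs : seq (n.-tuple R))
    (beta : n.-tuple R) (kappa : n.-tuple R -> R)
    (hk : R -> n.-tuple R -> n.-tuple R -> R) (t : R) (f : n.-tuple R -> R)
    (x : n.-tuple R) : R :=
  fine (muk_sint rs beta kappa (fun y => f y * hk t x y)).

(* hk is the (positive, symmetric, conservative) kernel of the semigroup
   (P_t) on L^2(mu_kappa) generated by the Dunkl Laplacian, i.e. whose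
   generator extends Delta_kappa on the Schwartz class (which is a core). *)
Definition dunkl_heat_kernel {R : realType} {n : nat} (rs : seq (n.-tuple R))
    (beta : n.-tuple R) (kappa : n.-tuple R -> R)
    (hk : R -> n.-tuple R -> n.-tuple R -> R) : Prop :=
  [/\
      measurable_fun [set u : R * (n.-tuple R * n.-tuple R) | 0 < u.1]
        (fun u => hk u.1 u.2.1 u.2.2) /\
      (forall t x y, 0 < t -> 0 < hk t x y),
      (forall t x y, 0 < t -> hk t x y = hk t y x),
      (forall t x, 0 < t -> muk_int rs beta kappa (fun y => (hk t x y)%:E) = 1%E) /\
      (forall t s x y, 0 < t -> 0 < s ->
         muk_int rs beta kappa (fun z => (hk t x z * hk s z y)%:E)
         = (hk (t + s) x y)%:E),
      (forall f, in_Lp rs beta kappa 2 f ->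
         (fun t => muk_int rs beta kappa
             (fun x => ((heat_op rs beta kappa hk t f x - f x) ^+ 2)%:E))
           x @[x --> 0^'+] --> 0%E)
    &
      (forall f, schwartz f ->
         (fun t => muk_int rs beta kappa
             (fun x => (((heat_op rs beta kappa hk t f x - f x) / t
                          - dunkl_laplacian rs beta kappa f x) ^+ 2)%:E))
           x @[x --> 0^'+] --> 0%E)].

Definition besov_Np {R : realType} {n : nat} (rs : seq (n.-tuple R))
    (beta : n.-tuple R) (kappa : n.-tuple R -> R)
    (hk : R -> n.-tuple R -> n.-tuple R -> R) (s p : R)
    (f : n.-tuple R -> R) : \bar R :=
  (\int[@lebesgue_measure R]_(t in [set t : R | (0 < t)%R])
     ((t `^ (- (1 + s * p / 2)))%:E *
      muk_int rs beta kappa (fun x =>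
        muk_int rs beta kappa (fun y =>
          (`|f y - f x| `^ p * hk t x y)%:E))))%E.

Definition in_besov {R : realType} {n : nat} (rs : seq (n.-tuple R))
    (beta : n.-tuple R) (kappa : n.-tuple R -> R)
    (hk : R -> n.-tuple R -> n.-tuple R -> R) (s p : R)
    (f : n.-tuple R -> R) : Prop :=
  in_Lp rs beta kappa p f /\ (besov_Np rs beta kappa hk s p f < +oo)%E.

(* Main.v *)
(** Write [P_t] for the semigroup with kernel [hk t] and
    [E t] for the double integral of [|f y - f x| ^ p * hk t x y], so that
    [s * N_{s,p}(f) ^ p] is [s] times the integral of [t ^ (- (1 + s p / 2)) E t].
    As [s -> 0], the times [t <= T] contribute nothing (the integral converges
    there for one [s0 > 0]), while the times [t >= T] contribute [2 / p] times
    the limit of [E] at infinity; hence it suffices that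
    [E t -> 2 ||f||_p ^ p].

    By a Brezis-Lieb type estimate, [|f y - f x| ^ p] differs from
    [|f x| ^ p + |f y| ^ p] by a small error, except where [x] and [y] both lie in
    a set [A] of finite measure on which [|f|] is bounded. So everything reduces
    to [<P_t 1_A, 1_A> -> 0]. Conservativeness, symmetry and the semigroup law
    turn the Dirichlet form of [u_n = P_n 1_A] into a telescoping sum, so
    [sum_n (u_n y - u_n z) ^ 2] is finite for almost all [(y, z)]
    since the kernel is positive: asymptotically [u_n] is constant in space. As
    [||u_n||_2] is bounded and the total mass of the measure is infinite, that
    constant is 0. *)
Require Import Defs.
From HB Require Import structures.
From mathcomp Require Import all_boot all_order all_algebra.
From mathcomp Require Import all_classical all_reals all_analysis.
From mathcomp Require Import measurable_realfun ring lra.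
Set Implicit Arguments.
Unset Strict Implicit.
Unset Printing Implicit Defensive.
Import Order.TTheory GRing.Theory Num.Theory.
Import numFieldNormedType.Exports.
Local Open Scope classical_set_scope.
Local Open Scope ring_scope.

(** * Symmetric Markov kernels: operators, forms on pairs, semigroup law *)

Lemma measurable_time_slice d (T : measurableType d) (R : realType)
    (k : R -> T -> T -> R) (t : R) :
  measurable_fun [set u : R * (T * T) | 0 < u.1] (fun u => k u.1 u.2.1 u.2.2) ->
  0 < t -> measurable_fun setT (fun z : T * T => k t z.1 z.2).
Proof.
move=> mk t0.
apply: (@measurable_comp _ _ _ _ _ _ [set u : R * (T * T) | 0 < u.1]
  (fun u => k u.1 u.2.1 u.2.2) setT (fun z => (t, z))).
- rewrite [X in measurable X](_ : _ = `]0, +oo[ `*` setT); last first.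
    by apply/seteqP; split => [[a b]|[a b]] /=; rewrite in_itv/= andbT// => -[].
  exact: measurableX.
- by move=> _ [z _ <-].
- exact: mk.
- exact: measurable_pair1.
Qed.

(** The properties of the heat kernel from which the limit is derived, isolated on a general
    measurable space. Measurability is joint in time and space so that the form can later be
    integrated over [t]. *)
Record markov_kernel d (T : measurableType d) (R : realType)
    (mu : set T -> \bar R) (k : R -> T -> T -> R) : Prop := MarkovKernel {
  kernel_measurable :
    measurable_fun [set u : R * (T * T) | 0 < u.1] (fun u => k u.1 u.2.1 u.2.2) ;
  kernel_gt0 : forall (t : R) x y, 0 < t -> 0 < k t x y ;
  kernel_sym : forall (t : R) x y, 0 < t -> k t x y = k t y x ;
  kernel_conservative : forall (t : R) x, 0 < t ->
    (\int[mu]_y (k t x y)%:E = 1)%E ;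
  kernel_semigroup : forall (t s : R) x y, 0 < t -> 0 < s ->
    (\int[mu]_z (k t x z * k s z y)%:E = (k (t + s) x y)%:E)%E }.

Section markov_kernel.
Context d (T : measurableType d) (R : realType).
Variables (mu : {sigma_finite_measure set T -> \bar R}) (k : R -> T -> T -> R).
Hypothesis markov_k : markov_kernel mu k.
Let k_gt0 := kernel_gt0 markov_k.
Let k_sym := kernel_sym markov_k.
Let k_markov := kernel_conservative markov_k.
Let k_semigroup := kernel_semigroup markov_k.

Local Open Scope ereal_scope.

Definition kernel_op t (g : T -> \bar R) x := \int[mu]_y (g y * (k t x y)%:E).

(** Integration against the measure on pairs with density [k t]; by conservativeness and symmetry
    both of its marginals are [mu]. *)
Definition kernel_form t (G : T * T -> \bar R) :=
  \int[mu \x mu]_z (G z * (k t z.1 z.2)%:E).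

Lemma measurable_ereal_kernel (t : R) : (0 < t)%R ->
  measurable_fun setT (fun z : T * T => (k t z.1 z.2)%:E).
Proof.
move=> t0; apply/measurable_EFinP.
exact: measurable_time_slice (kernel_measurable markov_k) t0.
Qed.

Lemma measurable_kernel_slice (t : R) x : (0 < t)%R ->
  measurable_fun setT (fun y => (k t x y)%:E).
Proof.
move=> t0; apply: (measurableT_comp (measurable_ereal_kernel t0)
  (g := fun y => (x, y))).
exact: measurable_pair1.
Qed.

Lemma kernel_ge0 (t : R) x y : (0 < t)%R -> 0 <= (k t x y)%:E.
Proof. by move=> t0; rewrite lee_fin ltW// k_gt0. Qed.

Section with_time.
Variable t : R.
Hypothesis t0 : (0 < t)%R.
Implicit Types (g h : T -> \bar R) (G H : T * T -> \bar R).

Let mkt := measurable_ereal_kernel t0.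
Let mkx x := measurable_kernel_slice x t0.
Let kt0 x y := kernel_ge0 x y t0.

Lemma kernel_op_ge0 g x : (forall y, 0 <= g y) -> 0 <= kernel_op t g x.
Proof. by move=> g0; apply: integral_ge0 => y _; rewrite mule_ge0. Qed.

Lemma measurable_kernel_op g : measurable_fun setT g -> (forall y, 0 <= g y) ->
  measurable_fun setT (kernel_op t g).
Proof.
move=> mg g0.
apply: (measurable_fun_fubini_tonelli_F (m2 := mu)
  (fun z : T * T => g z.2 * (k t z.1 z.2)%:E)).
- by apply: emeasurable_funM => //; exact: measurableT_comp.
- by move=> z; rewrite mule_ge0.
Qed.

Lemma kernel_op_le1 g x : measurable_fun setT g -> (forall y, 0 <= g y <= 1) ->
  kernel_op t g x <= 1.
Proof.
move=> mg g01; rewrite -(k_markov x t0); apply: ge0_le_integral => //.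
- by move=> y _; rewrite mule_ge0//; case/andP: (g01 y).
- exact: emeasurable_funM.
- by move=> y _; rewrite -[leRHS]mul1e lee_wpmul2r//; case/andP: (g01 y).
Qed.

Lemma kernel_formE G : measurable_fun setT G -> (forall z, 0 <= G z) ->
  kernel_form t G = \int[mu]_x \int[mu]_y (G (x, y) * (k t x y)%:E).
Proof.
move=> mG G0; rewrite /kernel_form fubini_tonelli1//.
- exact: emeasurable_funM.
- by move=> z; rewrite mule_ge0.
Qed.

Lemma kernel_formE_swap G : measurable_fun setT G -> (forall z, 0 <= G z) ->
  kernel_form t G = \int[mu]_y \int[mu]_x (G (x, y) * (k t x y)%:E).
Proof.
move=> mG G0; rewrite /kernel_form fubini_tonelli2//.
- exact: emeasurable_funM.
- by move=> z; rewrite mule_ge0.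
Qed.

Lemma kernel_form_ge0 G : (forall z, 0 <= G z) -> 0 <= kernel_form t G.
Proof. by move=> G0; apply: integral_ge0 => z _; rewrite mule_ge0. Qed.

Lemma le_kernel_form G H : measurable_fun setT G -> measurable_fun setT H ->
  (forall z, 0 <= G z) -> (forall z, G z <= H z) ->
  kernel_form t G <= kernel_form t H.
Proof.
move=> mG mH G0 GH; apply: ge0_le_integral => //.
- by move=> z _; rewrite mule_ge0.
- exact: emeasurable_funM.
- exact: emeasurable_funM.
- by move=> z _; rewrite lee_wpmul2r.
Qed.

Lemma kernel_formD G H : measurable_fun setT G -> measurable_fun setT H ->
  (forall z, 0 <= G z) -> (forall z, 0 <= H z) ->
  kernel_form t (fun z => G z + H z) = kernel_form t G + kernel_form t H.
Proof.
move=> mG mH G0 H0; rewrite /kernel_form -ge0_integralD//.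
- by apply: eq_integral => z _; rewrite ge0_muleDl.
- by move=> z _; rewrite mule_ge0.
- exact: emeasurable_funM.
- by move=> z _; rewrite mule_ge0.
- exact: emeasurable_funM.
Qed.

Lemma kernel_formZ c G : measurable_fun setT G -> (forall z, 0 <= G z) ->
  (0 <= c)%R -> kernel_form t (fun z => c%:E * G z) = c%:E * kernel_form t G.
Proof.
move=> mG G0 c0; rewrite /kernel_form -ge0_integralZl//.
- by apply: eq_integral => z _; rewrite muleA.
- exact: emeasurable_funM.
- by move=> z _; rewrite mule_ge0.
Qed.

Lemma kernel_form_fst g : measurable_fun setT g -> (forall x, 0 <= g x) ->
  kernel_form t (fun z => g z.1) = \int[mu]_x g x.
Proof.
move=> mg g0; rewrite kernel_formE//; last exact: measurableT_comp.
apply: eq_integral => x _ /=.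
by rewrite ge0_integralZl// ?k_markov ?mule1//.
Qed.

Lemma kernel_form_snd g : measurable_fun setT g -> (forall x, 0 <= g x) ->
  kernel_form t (fun z => g z.2) = \int[mu]_x g x.
Proof.
move=> mg g0; rewrite kernel_formE_swap//; last exact: measurableT_comp.
apply: eq_integral => y _ /=.
under eq_integral do rewrite k_sym//.
by rewrite ge0_integralZl// ?k_markov ?mule1//.
Qed.

Lemma kernel_form_tensor g h : measurable_fun setT g -> measurable_fun setT h ->
  (forall x, 0 <= g x) -> (forall x, 0 <= h x) ->
  kernel_form t (fun z => g z.1 * h z.2) = \int[mu]_x (g x * kernel_op t h x).
Proof.
move=> mg mh g0 h0; rewrite kernel_formE//.
- apply: eq_integral => x _ /=; rewrite /kernel_op -ge0_integralZl//.
  + by apply: eq_integral => y _; rewrite muleA.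
  + exact: emeasurable_funM.
  + by move=> y _; rewrite mule_ge0.
- by apply: emeasurable_funM; exact: measurableT_comp.
- by move=> z; rewrite mule_ge0.
Qed.

Lemma kernel_op_symmetric g h : measurable_fun setT g -> measurable_fun setT h ->
  (forall x, 0 <= g x) -> (forall x, 0 <= h x) ->
  \int[mu]_x (g x * kernel_op t h x) = \int[mu]_x (h x * kernel_op t g x).
Proof.
move=> mg mh g0 h0; rewrite -kernel_form_tensor// kernel_formE_swap//.
- apply: eq_integral => x _ /=; rewrite /kernel_op -ge0_integralZl//.
  + by apply: eq_integral => y _; rewrite k_sym// muleCA muleA.
  + exact: emeasurable_funM.
  + by move=> y _; rewrite mule_ge0.
- by apply: emeasurable_funM; exact: measurableT_comp.
- by move=> z; rewrite mule_ge0.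
Qed.

End with_time.

(** Tonelli brings the integral over the intermediate point inside, where the semigroup law of the
    kernel evaluates it. *)
Lemma kernel_op_comp (s t : R) g x : (0 < s)%R -> (0 < t)%R ->
  measurable_fun setT g -> (forall y, 0 <= g y) ->
  kernel_op s (kernel_op t g) x = kernel_op (s + t) g x.
Proof.
move=> s0 t0 mg g0.
pose G (z : T * T) := (k s x z.1)%:E * (g z.2 * (k t z.1 z.2)%:E).
have mG : measurable_fun setT G.
  apply: emeasurable_funM.
    by apply: (measurableT_comp (measurable_kernel_slice x s0)).
  apply: emeasurable_funM; [exact: measurableT_comp|exact: measurable_ereal_kernel].
have G0 z : 0 <= G z by rewrite !mule_ge0// kernel_ge0.
transitivity (\int[mu]_z \int[mu]_y G (z, y)).
  apply: eq_integral => z _; rewrite /kernel_op muleC -ge0_integralZl//.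
  - by apply: emeasurable_funM => //; exact: measurable_kernel_slice.
  - by move=> y _; rewrite mule_ge0// kernel_ge0.
  - exact: kernel_ge0.
rewrite fubini_tonelli//; apply: eq_integral => y _.
rewrite -k_semigroup// -ge0_integralZl//.
- by apply: eq_integral => z _; rewrite /G muleCA EFinM.
- under eq_fun do rewrite EFinM.
  apply: emeasurable_funM; first exact: measurable_kernel_slice.
  under eq_fun do rewrite k_sym//.
  exact: measurable_kernel_slice.
- by move=> z _; rewrite lee_fin mulr_ge0// ltW// k_gt0.
Qed.

End markov_kernel.

(** * Decay of correlations on a space of infinite mass *)

Lemma nneseries_sqr_cvg0 (R : realType) (w : nat -> R) :
  (\big[+%E/0%E]_(0 <= n <oo) ((w n ^+ 2)%:E) < +oo)%E -> w n @[n --> \oo] --> 0.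
Proof.
move=> /nneseries_tail_cvg => /(_ (fun n _ => sqr_ge0 (w n))) tail0.
have w20 : w n ^+ 2 @[n --> \oo] --> 0.
  have w2tail : \forall n \near \oo,
      (0 <= (w n ^+ 2)%:E <= \big[+%E/0%E]_(n <= i <oo) (w i ^+ 2)%:E)%E.
    apply: nearW => n; rewrite lee_fin sqr_ge0/=.
    apply: le_trans (nneseries_lim_ge n.+1 _) => [|i _ _]; last first.
      by rewrite lee_fin sqr_ge0.
    by rewrite big_nat1.
  have /fine_cvgP[_ //] : (w n ^+ 2)%:E @[n --> \oo] --> 0%E.
  apply: (squeeze_cvge w2tail); first exact: cvg_cst.
  exact: tail0.
apply/cvgrPdist_lt => e e0.
have e20 : 0 < e ^+ 2 by rewrite exprn_gt0.
move/cvgrPdist_lt : w20 => /(_ _ e20); apply: filterS => n.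
rewrite !sub0r !normrN normrX; rewrite ltr_pXn2r// ?nnegrE ?normr_ge0//.
exact: ltW.
Qed.

Lemma limn_einf_ge (R : realType) (w : nat -> \bar R) c :
  (\forall n \near \oo, (c <= w n)%E) -> (c <= limn_einf w)%E.
Proof.
move=> cw; rewrite limn_einf_lim; apply: lime_ge; first exact: is_cvg_einfs.
case: cw => N _ cw; exists N => // n /= Nn.
by apply: le_ereal_inf_tmp => _ [m /= nm <-]; apply: cw => /=; exact: leq_trans nm.
Qed.

Section decay.
Context d (T : measurableType d) (R : realType).
Variables (mu : {sigma_finite_measure set T -> \bar R}) (k : R -> T -> T -> R).
Hypothesis markov_k : markov_kernel mu k.
Variable A : set T.
Hypotheses (mA : measurable A) (muA : (mu A < +oo)%E).

Local Open Scope ereal_scope.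

Let chi x : \bar R := (\1_A x)%:E.
Let u t := kernel_op mu k t chi.
(** The autocorrelation of the indicator of [A]; at time [t + t] it is the squared L2 norm of
    [u t]. *)
Let a t := \int[mu]_x (chi x * u t x).

Let mchi : measurable_fun setT chi.
Proof. exact/measurable_EFinP/measurable_indic. Qed.

Let chi01 x : 0 <= chi x <= 1.
Proof. by rewrite /chi !lee_fin indicE; case: (x \in A); rewrite lexx ler01. Qed.

Let chi0 x : 0 <= chi x. Proof. by case/andP: (chi01 x). Qed.

Let u0 (t : R) x : (0 < t)%R -> 0 <= u t x.
Proof. by move=> t0; apply: kernel_op_ge0. Qed.

Let u1 (t : R) x : (0 < t)%R -> u t x <= 1.
Proof. by move=> t0; apply: kernel_op_le1. Qed.

Let mu_ (t : R) : (0 < t)%R -> measurable_fun setT (u t).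
Proof. by move=> t0; exact: measurable_kernel_op. Qed.

(** Real-valued version of [u t], in which differences can be squared safely; nothing is lost for
    [t > 0], since [u t] lies between 0 and 1. *)
Let v t x := fine (u t x).

Let vE (t : R) x : (0 < t)%R -> (v t x)%:E = u t x.
Proof.
move=> t0; rewrite fineK// fin_numE gt_eqF ?(lt_le_trans ltNy0 (u0 x t0))//=.
by rewrite lt_eqF// (le_lt_trans (u1 x t0))// ltry.
Qed.

Let mv (t : R) : (0 < t)%R -> measurable_fun setT (v t).
Proof. by move=> t0; apply: measurableT_comp => //; exact: mu_. Qed.

(** Self-adjointness moves the operator at time [s] onto the other factor, where it composes with
    the one at time [t]. *)
Lemma kernel_correlation (t s : R) : (0 < t)%R -> (0 < s)%R ->
  \int[mu]_x (u t x * u s x) = a (s + t).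
Proof.
move=> t0 s0.
have ut0 x : 0 <= u t x by exact: u0.
rewrite (kernel_op_symmetric markov_k s0 (mu_ t0) mchi ut0 chi0).
apply: eq_integral => x _; congr (_ * _).
exact: kernel_op_comp.
Qed.

Lemma kernel_correlation_ge0 (t : R) : (0 < t)%R -> 0 <= a t.
Proof. by move=> t0; apply: integral_ge0 => x _; rewrite mule_ge0// u0. Qed.

Lemma kernel_correlation_le (t : R) : (0 < t)%R -> a t <= mu A.
Proof.
move=> t0; rewrite -(setIT A) -integral_indic//; apply: ge0_le_integral => //.
- by move=> x _; rewrite mule_ge0// u0.
- by apply: emeasurable_funM => //; exact: mu_.
- by move=> x _; rewrite -[leRHS]mule1 lee_wpmul2l// u1.
Qed.

(** Expanding the square, each pure square integrates by the marginal property to the squared norm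
    [a (t + t)], and the cross term is the correlation of [u t] with [u (s + t)]. The identity is
    additive so that no extended reals are subtracted. *)
Lemma kernel_dirichlet (t s : R) : (0 < t)%R -> (0 < s)%R ->
  kernel_form mu k s (fun z => ((v t z.1 - v t z.2) ^+ 2)%:E) +
  2%:E * a (t + t + s) = 2%:E * a (t + t).
Proof.
move=> t0 s0.
have mv1 : measurable_fun setT (fun z : T * T => v t z.1).
  by apply: measurableT_comp => //; exact: mv.
have mv2 : measurable_fun setT (fun z : T * T => v t z.2).
  by apply: measurableT_comp => //; exact: mv.
have v0 x : (0 <= v t x)%R by rewrite fine_ge0// u0.
have -> : a (t + t + s) = kernel_form mu k s (fun z => (v t z.1 * v t z.2)%:E).
  under eq_fun do rewrite EFinM !vE//.
  have ut0 x : 0 <= u t x by exact: u0.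
  rewrite (kernel_form_tensor markov_k s0 (mu_ t0) (mu_ t0) ut0 ut0).
  have -> : (t + t + s = s + t + t)%R by ring.
  rewrite -(kernel_correlation t0 (addr_gt0 s0 t0)).
  apply: eq_integral => x _; congr (_ * _).
  exact/esym/(kernel_op_comp markov_k).
have muu : measurable_fun setT (fun x => u t x * u t x).
  by apply: emeasurable_funM; exact: mu_.
have uu0 x : 0 <= u t x * u t x by rewrite mule_ge0 ?u0.
rewrite -kernel_formZ//; last 2 first.
- by apply/measurable_EFinP; exact: measurable_funM.
- by move=> z; rewrite lee_fin mulr_ge0.
rewrite -kernel_formD//; last 4 first.
- by apply/measurable_EFinP; apply: measurable_funX; exact: measurable_funB.
- apply/measurable_EFinP; apply: measurable_funM => //.
  exact: measurable_funM.
- by move=> z; rewrite lee_fin sqr_ge0.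
- by move=> z; rewrite lee_fin !mulr_ge0.
transitivity (kernel_form mu k s (fun z => u t z.1 * u t z.1 + u t z.2 * u t z.2)).
  congr kernel_form; apply/funext => z.
  by rewrite -!vE// -!EFinM -!EFinD; congr EFin; ring.
rewrite kernel_formD//; last 2 first.
- by apply: (measurableT_comp muu).
- by apply: (measurableT_comp muu).
rewrite (kernel_form_fst markov_k s0 muu)// (kernel_form_snd markov_k s0 muu)//.
by rewrite kernel_correlation// -mule2n muleC -mule_natl muleC.
Qed.

(** The Dirichlet identity at time [r / 2] writes twice the drop of [a] as a nonnegative form. *)
Lemma kernel_correlation_decr (r s : R) : (0 < r)%R -> (0 < s)%R ->
  a (r + s) <= a r.
Proof.
move=> r0 s0; have r20 : (0 < r / 2)%R by rewrite divr_gt0.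
have D0 := kernel_form_ge0 markov_k s0
  (fun z => _ : 0 <= ((v (r / 2) z.1 - v (r / 2) z.2) ^+ 2)%:E).
have := kernel_dirichlet r20 s0; rewrite -splitr.
move: (kernel_form _ _ _ _) (a (r + s)) (a r) D0 => D y x D0 E.
rewrite -(@lee_pmul2l _ 2%:E)// -E leeDr//; apply: D0 => z.
by rewrite lee_fin sqr_ge0.
Qed.


(** The term of index [n] equals twice the drop of [a] from time [2n + 2] to [2n + 3]; monotonicity
    bridges the unit from [2n + 3] to [2n + 4], and the sum telescopes. *)
Lemma kernel_dirichlet_sum (N : nat) :
  \sum_(0 <= n < N) kernel_form mu k 1
     (fun z => ((v n.+1%:R z.1 - v n.+1%:R z.2) ^+ 2)%:E) +
  2%:E * a (N.+1%:R + N.+1%:R) <= 2%:E * a 2.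
Proof.
elim: N => [|N IH]; first by rewrite big_geq// add0e.
rewrite (@big_nat_recr _ _ _ N 0 _ (leq0n N)).
have N0 : (0 < N.+1%:R :> R)%R by rewrite ltr0n.
have := kernel_dirichlet N0 ltr01.
have := kernel_correlation_decr (addr_gt0 (addr_gt0 N0 N0) ltr01) ltr01.
have -> : (N.+1%:R + N.+1%:R + 1 + 1 = N.+2%:R + N.+2%:R :> R)%R.
  by rewrite -!natr1; ring.
move: (kernel_form _ _ _ _) (a _) (a _) (a _) (a _) (\sum_(_ <= _ < _) _) IH.
move=> D x y z w S IH yz E.
apply: le_trans IH; rewrite -[X in X <= _]addeA leeD2l// -E leeD2l// lee_wpmul2l//.
Qed.

Hypothesis muT : mu setT = +oo.

(** The sum of all squared oscillations is integrable against [k 1] on pairs, hence on the slice of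
    some [y0]. As [k 1] is strictly positive, the series is finite at almost every [z], and its
    terms tend to 0. *)
Lemma kernel_op_oscillation : exists y0, {ae mu, forall z,
  (v n.+1%:R y0 - v n.+1%:R z)%R @[n --> \oo] --> 0%R}.
Proof.
pose q n (z : T * T) : \bar R := ((v n.+1%:R z.1 - v n.+1%:R z.2) ^+ 2)%:E.
have n0 n : (0 < n.+1%:R :> R)%R by rewrite ltr0n.
have mq n : measurable_fun setT (q n).
  apply/measurable_EFinP; apply: measurable_funX; apply: measurable_funB;
    by apply: (measurableT_comp (mv _)).
have q0 n z : 0 <= q n z by rewrite lee_fin sqr_ge0.
have k0 z : 0 <= (k 1 z.1 z.2)%:E by exact: (kernel_ge0 markov_k).
have mk : measurable_fun setT (fun z : T * T => (k 1 z.1 z.2)%:E).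
  exact: (measurable_ereal_kernel markov_k).
pose S z := \big[+%E/0%E]_(0 <= n <oo) q n z.
have S0 z : 0 <= S z by apply: nneseries_ge0 => n _ _.
have mS : measurable_fun setT S by apply: ge0_emeasurable_sum => // n z _ _.
have ltS : kernel_form mu k 1 S < +oo.
  apply: (@le_lt_trans _ _ (2%:E * a 2)); last first.
    apply: lte_mul_pinfty => //; exact: le_lt_trans (kernel_correlation_le _) muA.
  have -> : kernel_form mu k 1 S = \big[+%E/0%E]_(0 <= n <oo) kernel_form mu k 1 (q n).
    rewrite /kernel_form -integral_nneseries//; last 2 first.
    - by move=> n; exact: emeasurable_funM.
    - by move=> n z _; exact: mule_ge0.
    apply: eq_integral => z _; rewrite muleC -nneseriesZl//.
    by apply: eq_eseriesr => n _; rewrite muleC.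
  apply: lime_le.
    by apply: is_cvg_nneseries => n _ _; apply: kernel_form_ge0.
  apply: nearW => N; apply: le_trans (kernel_dirichlet_sum N).
  apply: leeDl; apply: mule_ge0; first by rewrite lee_fin.
  by apply: kernel_correlation_ge0; exact: addr_gt0.
(* If every slice were infinite, the form of [S] would be [+oo * mu setT], which is infinite. *)
have [y0 Hy0] : exists y0, \int[mu]_z (S (y0, z) * (k 1 y0 z)%:E) < +oo.
  apply: contrapT => /forallNP noy.
  move: ltS; rewrite (kernel_formE markov_k)//.
  rewrite (eq_integral (cst +oo)); last first.
    by move=> y _; apply/eqP; rewrite -leye_eq leNgt; exact/negP/noy.
  by rewrite integral_cst// [X in _ * X]muT mulyy ltxx.
exists y0.
have mSk : measurable_fun setT (fun z => S (y0, z) * (k 1 y0 z)%:E).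
  apply: emeasurable_funM.
    by apply: (measurableT_comp mS).
  exact: (measurable_kernel_slice markov_k).
have iS : mu.-integrable setT (fun z => S (y0, z) * (k 1 y0 z)%:E).
  apply/integrableP; split => //.
  rewrite (eq_integral (fun z => S (y0, z) * (k 1 y0 z)%:E))// => z _.
  by rewrite gee0_abs// mule_ge0// (k0 (y0, z)).
apply: filterS (integrable_ae measurableT iS) => z /(_ Logic.I) Sfin.
apply: nneseries_sqr_cvg0; rewrite -/(S (y0, z)) ltey; apply/negP => /eqP Sy.
by move: Sfin; rewrite Sy gt0_mulye// lte_fin (kernel_gt0 markov_k).
Qed.

(** By contradiction: if [a] stays above [e], the mean of [u n] over [A] stays bounded below, and by
    vanishing oscillation so does [u n] almost everywhere on the whole space. Fatou then contradicts
    the bound [mu A] on the squared norms. *)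
Lemma kernel_correlation_cvg0 (e : R) : (0 < e)%R ->
  exists M : R, (0 < M)%R /\ forall t : R, (M <= t)%R -> a t <= e%:E.
Proof.
move=> e0.
(* One good time is enough, because [a] is nonincreasing. *)
suff [M [M0 aM]] : exists M : R, (0 < M)%R /\ a M <= e%:E.
  exists M; split; first exact: M0.
  move=> t; rewrite le_eqVlt => /predU1P[<-//|Mt].
  apply: le_trans aM; rewrite -(subrKC M t).
  by apply: kernel_correlation_decr; rewrite ?subr_gt0.
apply: contrapT => noM.
have ae t : (0 < t)%R -> e%:E < a t.
  by move=> t0; rewrite ltNge; apply/negP => at_; apply: noM; exists t.
have n0 n : (0 < n.+1%:R :> R)%R by rewrite ltr0n.
have muA_fin : mu A \is a fin_num by rewrite ge0_fin_numE.
pose m := fine (mu A).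
have mE : mu A = m%:E by rewrite /m fineK.
have m0 : (0 < m)%R.
  rewrite -lte_fin -mE; apply: lt_le_trans (kernel_correlation_le ltr01).
  by apply: lt_trans (ae _ ltr01); rewrite lte_fin.
have [y0 v_y0] := kernel_op_oscillation.
pose D n z : R := `|v n.+1%:R y0 - v n.+1%:R z|%R.
have v01 n z : (0 <= v n.+1%:R z <= 1)%R.
  by rewrite -!lee_fin vE// u0//= u1.
have mD n : measurable_fun setT (D n).
  by apply: measurableT_comp => //; apply: measurable_funB => //; exact: mv.
(* On [A], which has finite measure, the constant 1 dominates the oscillation, so pointwise decay
   becomes decay in mean. *)
have intD0 : \int[mu]_(z in A) (D n z)%:E @[n --> \oo] --> 0.
  have [] := @dominated_convergence _ _ _ mu A mA (fun n z => (D n z)%:E)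
    (cst 0) (cst 1).
  - by move=> n; apply/measurable_EFinP; apply: measurable_funTS; exact: mD.
  - exact: measurable_cst.
  - apply: filterS v_y0 => z vz _; apply: cvg_EFin; first exact: nearW.
    exact/norm_cvg0P.
  - apply/integrableP; split; first exact: measurable_cst.
    rewrite (eq_integral (cst 1)); last by move=> z _; rewrite /= normr1.
    by rewrite integral_cst// mul1e.
  - apply: aeW => z n _; rewrite /= lee_fin normr_id.
    rewrite ler_norml; case/andP: (v01 n z) => ? ?; case/andP: (v01 n y0) => ? ?.
    by apply/andP; split; lra.
  - by move=> _ _; rewrite integral0.
have av n : a n.+1%:R <= \int[mu]_(z in A) (D n z)%:E + (v n.+1%:R y0 * m)%:E.
  rewrite EFinM -mE -integral_cst// -ge0_integralD//; last 3 first.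
  - by move=> z _; rewrite lee_fin normr_ge0.
  - by apply/measurable_EFinP; apply: measurable_funTS; exact: mD.
  - by move=> z _; rewrite /= lee_fin; case/andP: (v01 n y0).
  rewrite [leRHS]integral_mkcond; apply: ge0_le_integral => //.
  - by move=> x _; apply: mule_ge0 => //; exact: u0.
  - by apply: emeasurable_funM => //; exact: mu_.
  - apply/(measurable_restrictT _ mA); apply: emeasurable_funD => //.
    by apply/measurable_EFinP; apply: measurable_funTS; exact: mD.
  move=> x _; rewrite patchE /chi indicE; case: ifPn => _; last by rewrite mul0e.
  rewrite mul1e -vE//= -EFinD lee_fin /D.
  have := ler_norm (v n.+1%:R x - v n.+1%:R y0)%R.
  by rewrite distrC; case/andP: (v01 n y0); lra.
(* Chosen so that [2 * c * m = e / 2]: half of [e] pays for the oscillation over [A], the other half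
   forces [2 * c] at [y0], of which [c] survives at almost every other point. *)
pose c := (e / (4 * m))%R.
have c0 : (0 < c)%R by rewrite divr_gt0// mulr_gt0.
have cm : (c * m = e / 4)%R by rewrite /c; field; rewrite gt_eqF.
have near_y0 : \forall n \near \oo, (2 * c <= v n.+1%:R y0)%R.
  move/fine_cvgP : intD0 => [fin_intD /cvgr0Pnorm_lt] /(_ (e / 2)%R).
  rewrite divr_gt0// => /(_ isT) intD.
  near=> N.
  have : e%:E < a N.+1%:R by exact: ae.
  move=> /lt_le_trans /(_ (av N)).
  have : (`|fine (\int[mu]_(z in A) (D N z)%:E)%E| < e / 2)%R by near: N.
  have fin_N : \int[mu]_(z in A) (D N z)%:E \is a fin_num by near: N.
  rewrite /= -[X in X + _](fineK fin_N) -EFinD lte_fin ltr_norml => /andP[_ lt1 lt2].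
  rewrite -(ler_pM2r m0) -mulrA cm; lra.
have ae_ge : {ae mu, forall z, (c ^+ 2)%:E <=
    limn_einf (fun n => ((v n.+1%:R z) ^+ 2)%:E)}.
  apply: filterS v_y0 => z /cvgr0Pnorm_lt /(_ _ c0) near_z.
  apply: limn_einf_ge; near=> N; rewrite lee_fin.
  have v_y0N : (2 * c <= v N.+1%:R y0)%R by near: N.
  have : (`|v N.+1%:R y0 - v N.+1%:R z| < c)%R by near: N.
  rewrite ltr_norml => /andP[_ ?].
  by rewrite lerXn2r// ?nnegrE; lra.
have mv2 n : measurable_fun setT (fun z => ((v n.+1%:R z) ^+ 2)%:E).
  by apply/measurable_EFinP; apply: measurable_funX; exact: mv.
(* Fatou, with the integrals of the squares equal to [a] at time [2n + 2], hence at most [mu A]; on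
   a space of infinite mass the left side is infinite. *)
have : \int[mu]_z (cst (c ^+ 2)%:E z) <= mu A.
  apply: (@le_trans _ _ (\int[mu]_z limn_einf (fun n => ((v n.+1%:R z) ^+ 2)%:E))).
    apply: ae_ge0_le_integral => //.
    - by move=> z _; rewrite lee_fin sqr_ge0.
    - move=> z _; apply: limn_einf_ge; apply: nearW => n.
      by rewrite lee_fin sqr_ge0.
    - pose f n z := ((v n.+1%:R z) ^+ 2)%:E.
      apply: (emeasurable_fun_cvg (fun n z => einfs (f ^~ z) n)).
        by move=> n; apply: measurable_fun_einfs => i; exact: mv2.
      by move=> z _; rewrite limn_einf_lim; exact: is_cvg_einfs.
    - by apply: filterS ae_ge => z.
  apply: le_trans (fatou _ _ mv2 _) _ => //.
    by move=> n z _; rewrite lee_fin sqr_ge0.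
  rewrite limn_einf_lim; apply: lime_le; first exact: is_cvg_einfs.
  apply: nearW => n; apply: ge_ereal_inf; exists (a (n.+1%:R + n.+1%:R)).
    exists n => //=; rewrite -kernel_correlation//.
    by apply: eq_integral => z _; rewrite expr2 EFinM !vE.
  by apply: kernel_correlation_le; exact: addr_gt0.
rewrite integral_cst// [X in _ * X]muT gt0_muley ?lte_fin ?exprn_gt0//.
by move/le_lt_trans/(_ muA); rewrite ltxx.
Unshelve. all: by end_near.
Qed.
End decay.

(** * A Brezis-Lieb estimate and truncation of integrable functions *)

Lemma powR_near1 (R : realType) (p e : R) : 0 < e ->
  exists2 d : R, 0 < d < 1 & forall x, `|x| <= d -> `|(1 + x) `^ p - 1| <= e.
Proof.
move=> e0.
have : {for 1, continuous (fun x : R => x `^ p)}.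
  apply/differentiable_continuous/derivable1_diffP.
  by apply: derivable_powR; rewrite in_itv/= ltr01.
move/cvgrPdist_le => /(_ _ e0); rewrite powR1 => /nbhs_ballP[r /= r0 ball_r].
exists (Num.min (r / 2) (1 / 2)).
  by rewrite lt_min !divr_gt0//= gt_min orbC ltr_pdivrMr// mul1r ltrDl ltr01.
move=> x; rewrite le_min => /andP[xr _]; rewrite distrC; apply: ball_r.
rewrite -ball_normE/= opprD addNKr normrN.
by rewrite (le_lt_trans xr)// ltr_pdivrMr// ltr_pMr// ltrDl.
Qed.

(** Two regimes. If [|a| <= d * |b|], factoring out [|b|] reduces the claim to continuity of the
    power at 1. Otherwise [|b|] is at most [|a| / d], and the three summands of [C] bound the three
    powers by multiples of the power of [|a|]. The large constant falls on one variable only, and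
    which one is free to choose. *)
Lemma powR_dist_estimate (R : realType) (p e : R) : 0 < p -> 0 < e ->
  exists2 C : R, 0 <= C & forall a b : R,
    `| `|b - a| `^ p - (`|a| `^ p + `|b| `^ p)| <= e * `|b| `^ p + C * `|a| `^ p.
Proof.
move=> p0 e0; have [d /andP[d0 d1] near1] := powR_near1 p e0.
have C0 : 0 <= (1 + d^-1) `^ p + 1 + d^-1 `^ p.
  by rewrite !addr_ge0// powR_ge0.
exists ((1 + d^-1) `^ p + 1 + d^-1 `^ p) => // a b.
have pow0 (x : R) : 0 <= `|x| `^ p by exact: powR_ge0.
have [ab|ba] := lerP `|a| (d * `|b|).
- have [b0|b0] := eqVneq b 0.
    move: ab; rewrite b0 normr0 mulr0 normr_le0 => /eqP ->.
    by rewrite subr0 normr0 powR0 ?gt_eqF// !mulr0 !addr0 subrr normr0.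
  have nb0 : 0 < `|b| by rewrite normr_gt0.
  have abd : `|- (a / b)| <= d by rewrite normrN normf_div ler_pdivrMr.
  have -> : `|b - a| `^ p = `|b| `^ p * (1 - a / b) `^ p.
    have ab1 : 0 <= 1 - a / b.
      by move: abd; rewrite ler_norml => /andP[? ?]; lra.
    rewrite -powRM// -[X in _ * X](ger0_norm ab1) -normrM mulrBr mulr1.
    by rewrite mulrCA mulfV// mulr1.
  have := near1 _ abd.
  set u := _ `^ p; set v := `|b| `^ p; set w := `|a| `^ p => ue.
  have -> : v * u - (w + v) = v * (u - 1) - w by ring.
  apply: le_trans (ler_normB _ _) _; apply: lerD.
    by rewrite normrM (ger0_norm (pow0 b)) (mulrC e) ler_wpM2l// pow0.
  rewrite (ger0_norm (pow0 a)); apply: ler_peMl; first exact: pow0.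
  have := powR_ge0 (1 + d^-1) p; have := powR_ge0 (d^-1) p; lra.
- have di0 : 0 < d^-1 by rewrite invr_gt0.
  have bda : `|b| <= d^-1 * `|a| by rewrite mulrC ler_pdivlMr// mulrC ltW.
  have bp : `|b| `^ p <= d^-1 `^ p * `|a| `^ p.
    rewrite -powRM ?(ltW di0)//.
    by apply: ge0_ler_powR; rewrite ?nnegrE ?mulr_ge0 ?(ltW di0) ?(ltW p0).
  have bap : `|b - a| `^ p <= (1 + d^-1) `^ p * `|a| `^ p.
    have d10 : 0 <= 1 + d^-1 by rewrite addr_ge0// ltW.
    rewrite -powRM//; apply: ge0_ler_powR; rewrite ?nnegrE ?mulr_ge0 ?(ltW p0)//.
    by apply: le_trans (ler_normB _ _) _; lra.
  rewrite ler_norml.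
  have := pow0 (b - a); have := pow0 a; have := pow0 b.
  have : 0 <= e * `|b| `^ p by rewrite mulr_ge0// ltW.
  have := powR_ge0 (1 + d^-1) p; have := powR_ge0 (d^-1) p.
  rewrite !mulrDl mul1r.
  move=> *; apply/andP; split; lra.
Qed.

(** Take a band [n.+1^-1 <= g <= n.+1]: its lower edge gives finite measure by Markov's inequality,
    its upper edge gives boundedness. The bands exhaust the set where [g] is positive, so dominated
    convergence makes the remaining integral small. *)
Lemma integrable_truncation d (T : measurableType d) (R : realType)
    (mu : {measure set T -> \bar R}) (g : T -> R) (eta : R) :
  measurable_fun setT g -> (forall x, 0 <= g x) ->
  (\int[mu]_x (g x)%:E < +oo)%E -> 0 < eta ->
  exists A : set T, exists m : R, [/\ measurable A, (mu A < +oo)%E, 0 <= m,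
    (forall x, A x -> g x <= m) &
    (\int[mu]_x (g x * \1_(~` A) x)%:E <= eta%:E)%E].
Proof.
move=> mg g0 gfin eta0.
pose A n := [set x | n.+1%:R^-1 <= g x <= n.+1%:R].
have mA n : measurable (A n).
  rewrite [X in measurable X](_ : _ = setT `&` g @^-1` `[n.+1%:R^-1, n.+1%:R]%classic).
    exact: mg.
  by apply/seteqP; split => x /=; rewrite in_itv/=; tauto.
have mE : measurable_fun setT (fun x => (g x)%:E) by exact/measurable_EFinP.
have mgA n : measurable_fun setT (fun x => (g x * \1_(~` A n) x)%:E).
  apply/measurable_EFinP; apply: measurable_funM => //.
  by apply: measurable_indic; exact: measurableC.
have muA n : (mu (A n) < +oo)%E.
  have : (n.+1%:R^-1%:E * mu (A n) < +oo)%E.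
    rewrite -integral_cst//; apply: le_lt_trans gfin.
    apply: (@le_trans _ _ (\int[mu]_(x in A n) (g x)%:E)%E).
      apply: ge0_le_integral => //.
      - by move=> x _; rewrite lee_fin.
      - exact: measurable_funTS.
      - by move=> x /andP[? _]; rewrite lee_fin.
    by apply: ge0_subset_integral => // x _; rewrite lee_fin.
  apply: contraTT; rewrite -!leNgt !leye_eq => /eqP ->.
  by rewrite gt0_muley// lte_fin invr_gt0.
have ig : mu.-integrable setT (fun x => (g x)%:E).
  apply/integrableP; split => //.
  by under eq_integral do rewrite /= ger0_norm//.
have cvg0 : {ae mu, forall x, setT x ->
    (g x * \1_(~` A n) x)%:E @[n --> \oo] --> (0 : \bar R)%E}.
  apply: aeW => x _.
  have [gx0|gx0] := eqVneq (g x) 0.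
    by under eq_fun do rewrite gx0 mul0r; exact: cvg_cst.
  have gx : 0 < g x by rewrite lt_neqAle eq_sym gx0 g0.
  apply: cvg_near_cst; near=> n.
  rewrite indicE; case: (boolP (_ \in _)); last by rewrite mulr0.
  rewrite inE /A/= => nA; exfalso; apply: nA.
  have nS (r : R) : r <= n%:R -> r <= n.+1%:R.
    by move=> /le_trans; apply; rewrite ler_nat.
  apply/andP; split.
    rewrite -[leRHS]invrK lef_pV2 ?posrE ?invr_gt0//; apply/nS.
    by near: n; exact: nbhs_infty_ger.
  by apply/nS; near: n; exact: nbhs_infty_ger.
have dom : {ae mu, forall x n, setT x ->
    (`|(g x * \1_(~` A n) x)%:E| <= (g x)%:E)%E}.
  apply: aeW => x n _; rewrite /= lee_fin indicE.
  by case: (_ \in _); rewrite ?mulr1 ?mulr0 ?normr0// ger0_norm.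
have [_ _] := dominated_convergence measurableT mgA
  (measurable_cst 0%E) cvg0 ig dom.
rewrite integral0 => /fine_cvgP [fin0 /cvgr0Pnorm_le/(_ _ eta0) le_eta].
have [n [fin_n le_n]] : exists n,
    (\int[mu]_x (g x * \1_(~` A n) x)%:E)%E \is a fin_num /\
    `|fine (\int[mu]_x (g x * \1_(~` A n) x)%:E)%E| <= eta.
  near \oo => n; exists n; split; near: n; [exact: fin0|exact: le_eta].
exists (A n), n.+1%:R; split => //; first by move=> x /andP[].
by rewrite -(fineK fin_n) lee_fin (le_trans (ler_norm _)).
Unshelve. all: by end_near.
Qed.

(** * Large-time limit of the increment form *)

Section kernel_increment.
Context d (T : measurableType d) (R : realType).
Variables (mu : {sigma_finite_measure set T -> \bar R}) (k : R -> T -> T -> R).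
Hypotheses (markov_k : markov_kernel mu k) (muT : mu setT = +oo%E).
Variables (p : R) (f : T -> R).
Hypotheses (p0 : 0 < p) (mf : measurable_fun setT f).
Hypothesis f_Lp : (\int[mu]_x (`|f x| `^ p)%:E < +oo)%E.

Local Open Scope ereal_scope.

Let g x := (`|f x| `^ p)%R.
Let G (z : T * T) := (`|f z.2 - f z.1| `^ p)%R.

Let g0 x : (0 <= g x)%R. Proof. exact: powR_ge0. Qed.
Let G0 z : (0 <= G z)%R. Proof. exact: powR_ge0. Qed.

Let mg : measurable_fun setT g.
Proof.
apply: (measurableT_comp (measurable_powR p)).
exact: measurableT_comp.
Qed.

Let mG : measurable_fun setT G.
Proof.
apply: (measurableT_comp (measurable_powR p)).
apply: measurableT_comp => //.
by apply: measurable_funB; exact: measurableT_comp.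
Qed.

(** [G] is compared with [S z = g z.1 + g z.2], whose form is exactly twice the integral of [g] at
    every positive time. The error is dominated by [Q], whose form is at most [e] for large [t]. *)
Lemma kernel_increment_cvg (e : R) : (0 < e)%R -> exists M : R, (0 < M)%R /\
  forall t : R, (M <= t)%R ->
    kernel_form mu k t (EFin \o G) <= (2 * fine (\int[mu]_x (g x)%:E) + e)%:E /\
    (2 * fine (\int[mu]_x (g x)%:E))%:E <= kernel_form mu k t (EFin \o G) + e%:E.
Proof.
move=> e0; set F := \int[mu]_x (g x)%:E.
have F0 : 0 <= F by apply: integral_ge0 => x _; rewrite lee_fin.
have F_fin : F \is a fin_num by rewrite ge0_fin_numE.
have fF0 : (0 <= fine F)%R by rewrite fine_ge0.
(* [e1], [e2] and [e3] make each of the three summands of [Q] cost at most [e / 3]; the [+ 1] in the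
   denominators allows [fine F], [C] or [K] to vanish. *)
pose e1 := (e / (6 * (fine F + 1)))%R.
have e10 : (0 < e1)%R by rewrite divr_gt0// mulr_gt0// ltr_wpDl.
have e1F : (2 * e1 * fine F <= e / 3)%R.
  rewrite /e1 -subr_ge0.
  rewrite (_ : _ - _ = (e / 3) / (fine F + 1))%R; last by field; lra.
  by rewrite divr_ge0//; lra.
have [C C0 BL] := powR_dist_estimate p0 e10.
pose e2 := (e / (6 * (C + 1)))%R.
have e20 : (0 < e2)%R by rewrite divr_gt0// mulr_gt0// ltr_wpDl.
have e2C : (2 * C * e2 <= e / 3)%R.
  rewrite /e2 -subr_ge0.
  rewrite (_ : _ - _ = (e / 3) / (C + 1))%R; last by field; lra.
  by rewrite divr_ge0//; lra.
have [A [m [mA muA m0 gA tailA]]] := integrable_truncation mg g0 f_Lp e20.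
(* Bounds the Brezis-Lieb error on pairs with both points in [A], where [g <= m]. *)
pose K := ((e1 + C) * m)%R.
have K0 : (0 <= K)%R by rewrite mulr_ge0// addr_ge0// ltW.
pose e3 := (e / (3 * (K + 1)))%R.
have e30 : (0 < e3)%R by rewrite divr_gt0// mulr_gt0// ltr_wpDl.
have e3K : (K * e3 <= e / 3)%R.
  rewrite /e3 -subr_ge0.
  rewrite (_ : _ - _ = (e / 3) / (K + 1))%R; last by field; lra.
  by rewrite divr_ge0//; lra.
have [M [M0 decay]] := kernel_correlation_cvg0 markov_k mA muA muT e30.
exists M; split => // t Mt; have t0 : (0 < t)%R by exact: lt_le_trans Mt.
pose h x := (g x * \1_(~` A) x)%R.
have h0 x : (0 <= h x)%R by rewrite mulr_ge0.
have mh : measurable_fun setT h.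
  by apply: measurable_funM => //; apply: measurable_indic; exact: measurableC.
have mI : measurable_fun setT (\1_A : T -> R) by exact: measurable_indic.
have I0 x : (0 <= \1_A x :> R)%R by [].
pose S z := (g z.1 + g z.2)%R.
pose Q z := (e1 * S z + C * (h z.1 + h z.2) + K * (\1_A z.1 * \1_A z.2))%R.
have S0 z : (0 <= S z)%R by rewrite addr_ge0.
(* If one of the points lies outside [A], the estimate is used with [C] on such a point, where [g]
   agrees with [h], of small integral. Pairs inside [A] are absorbed by [K]. *)
have GS z : (`|G z - S z| <= Q z)%R.
  have e1S : (0 <= e1 * S z)%R by rewrite mulr_ge0// ltW.
  have Ch : (0 <= C * (h z.1 + h z.2))%R by rewrite mulr_ge0// addr_ge0.
  have KI : (0 <= K * (\1_A z.1 * \1_A z.2))%R.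
    by apply: mulr_ge0 => //; exact: mulr_ge0.
  have BL1 : (`|G z - S z| <= e1 * g z.2 + C * g z.1)%R by exact: BL.
  have BL2 : (`|G z - S z| <= e1 * g z.1 + C * g z.2)%R.
    have := BL (f z.2) (f z.1).
    by rewrite (distrC (f z.1)) /S (addrC (g z.1)).
  have eg x : (0 <= e1 * g x)%R by rewrite mulr_ge0// ltW.
  have Cg x : (0 <= C * g x)%R by rewrite mulr_ge0.
  move: e1S Ch KI; rewrite /Q /S /h !indicE !in_setC.
  case: (boolP (z.1 \in A)) => z1; case: (boolP (z.2 \in A)) => z2 /=;
    rewrite ?mulr1 ?mulr0 ?addr0 ?add0r => e1S Ch KI.
  - apply: le_trans BL1 _; apply: le_trans (_ : K <= _)%R; last by lra.
    rewrite /K mulrDl lerD// ler_wpM2l// ?(ltW e10)// gA//; exact/set_mem.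
  - by apply: le_trans BL2 _; rewrite mulrDr; have := eg z.2; lra.
  - by apply: le_trans BL1 _; rewrite mulrDr; have := eg z.1; lra.
  - by apply: le_trans BL1 _; rewrite !mulrDr; have := eg z.1; have := Cg z.2; lra.
have mfst (q : T -> R) : measurable_fun setT q ->
    measurable_fun setT (fun z : T * T => q z.1).
  by move=> mq; exact: (measurableT_comp mq).
have msnd (q : T -> R) : measurable_fun setT q ->
    measurable_fun setT (fun z : T * T => q z.2).
  by move=> mq; exact: (measurableT_comp mq).
have mS : measurable_fun setT S by apply: measurable_funD; [exact: mfst|exact: msnd].
have kf_sum (q : T -> R) : measurable_fun setT q -> (forall x, 0 <= q x)%R ->
    kernel_form mu k t (fun z => (q z.1 + q z.2)%:E) =
    2%:E * \int[mu]_x (q x)%:E.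
  move=> mq q0; under eq_fun do rewrite EFinD.
  rewrite (kernel_formD markov_k t0); last 4 first.
  - by apply/measurable_EFinP; exact: mfst.
  - by apply/measurable_EFinP; exact: msnd.
  - by move=> z; rewrite lee_fin.
  - by move=> z; rewrite lee_fin.
  have mqE : measurable_fun setT (EFin \o q) by exact/measurable_EFinP.
  rewrite (kernel_form_fst markov_k t0 mqE)// (kernel_form_snd markov_k t0 mqE)//.
  by rewrite -mule2n muleC -mule_natl muleC.
have mh2 : measurable_fun setT (fun z : T * T => h z.1 + h z.2)%R.
  by apply: measurable_funD; [exact: mfst|exact: msnd].
have mII : measurable_fun setT (fun z : T * T => \1_A z.1 * \1_A z.2 : R)%R.
  by apply: measurable_funM; [exact: mfst|exact: msnd].
have mQ : measurable_fun setT Q.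
  apply: measurable_funD; last by apply: measurable_funM => //; exact: mII.
  by apply: measurable_funD; apply: measurable_funM.
have Q0 z : (0 <= Q z)%R by apply: le_trans (GS z); exact: normr_ge0.
have kfS : kernel_form mu k t (EFin \o S) = (2 * fine F)%:E.
  by rewrite kf_sum// EFinM fineK.
have kfQ : kernel_form mu k t (EFin \o Q) <= e%:E.
  have -> : EFin \o Q = fun z => e1%:E * (S z)%:E + C%:E * (h z.1 + h z.2)%:E +
      K%:E * (\1_A z.1 * \1_A z.2)%:E.
    by apply/funext => z; rewrite -!EFinM -!EFinD.
  have m1 : measurable_fun setT (fun z => e1%:E * (S z)%:E).
    by apply: measurable_funeM; exact/measurable_EFinP.
  have m2 : measurable_fun setT (fun z : T * T => C%:E * (h z.1 + h z.2)%:E).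
    by apply: measurable_funeM; exact/measurable_EFinP.
  have m3 : measurable_fun setT (fun z : T * T => K%:E * (\1_A z.1 * \1_A z.2)%:E).
    by apply: measurable_funeM; exact/measurable_EFinP.
  have p1 z : 0 <= e1%:E * (S z)%:E by rewrite lee_fin mulr_ge0// ltW.
  have p2 (z : T * T) : 0 <= C%:E * (h z.1 + h z.2)%:E.
    by rewrite lee_fin mulr_ge0// addr_ge0.
  have p3 (z : T * T) : 0 <= K%:E * (\1_A z.1 * \1_A z.2)%:E.
    by rewrite lee_fin; apply: mulr_ge0 => //; exact: mulr_ge0.
  rewrite (kernel_formD markov_k t0 (emeasurable_funD m1 m2) m3)//; last first.
    by move=> z; rewrite adde_ge0.
  rewrite (kernel_formD markov_k t0 m1 m2)//.
  rewrite !(kernel_formZ markov_k t0)//; last 5 first.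
  - exact/measurable_EFinP.
  - exact/measurable_EFinP.
  - by move=> z; rewrite lee_fin addr_ge0.
  - exact/measurable_EFinP.
  - exact: ltW.
  rewrite [X in e1%:E * X]kfS kf_sum//.
  have corr : kernel_form mu k t (fun z => (\1_A z.1 * \1_A z.2)%:E) <= e3%:E.
    under eq_fun do rewrite EFinM.
    have mIE : measurable_fun setT (fun x => (\1_A x)%:E : \bar R).
      exact/measurable_EFinP.
    by rewrite (kernel_form_tensor markov_k t0 mIE mIE)// decay.
  have -> : e = (e / 3 + e / 3 + e / 3)%R by field.
  rewrite !EFinD; apply: leeD; first apply: leeD.
  - by rewrite -EFinM lee_fin; lra.
  - apply: (@le_trans _ _ (C%:E * (2%:E * e2%:E))).
      by rewrite !lee_wpmul2l ?lee_fin.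
    by rewrite -!EFinM lee_fin; lra.
  - apply: (@le_trans _ _ (K%:E * e3%:E)); first by rewrite lee_wpmul2l ?lee_fin.
    by rewrite -EFinM lee_fin.
(* Both bounds integrate an additive inequality, [G <= S + Q] and [S <= G + Q]. *)
split.
- apply: (@le_trans _ _ (kernel_form mu k t (fun z => (S z)%:E + (Q z)%:E))).
    apply: (le_kernel_form markov_k t0).
    + exact/measurable_EFinP.
    + by apply: emeasurable_funD; exact/measurable_EFinP.
    + by move=> z; rewrite /= lee_fin.
    + move=> z; rewrite /= -EFinD lee_fin.
      by have := GS z; rewrite ler_norml => /andP[_]; lra.
  rewrite (kernel_formD markov_k t0); last 4 first.
  + exact/measurable_EFinP.
  + exact/measurable_EFinP.
  + by move=> z; rewrite /= lee_fin.
  + by move=> z; rewrite /= lee_fin.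
  by rewrite kfS EFinD leeD2l.
- rewrite -kfS; apply: (@le_trans _ _ (kernel_form mu k t (fun z => (G z)%:E + (Q z)%:E))).
    apply: (le_kernel_form markov_k t0).
    + exact/measurable_EFinP.
    + by apply: emeasurable_funD; exact/measurable_EFinP.
    + by move=> z; rewrite /= lee_fin.
    + move=> z; rewrite /= -EFinD lee_fin.
      by have := GS z; rewrite ler_norml => /andP[]; lra.
  rewrite (kernel_formD markov_k t0); last 4 first.
  + exact/measurable_EFinP.
  + exact/measurable_EFinP.
  + by move=> z; rewrite /= lee_fin.
  + by move=> z; rewrite /= lee_fin.
  by rewrite leeD2l.
Qed.
End kernel_increment.

(** * The limit in [s] of the weighted time integral *)

Lemma cvge_fin_dist_le (T : Type) (F : set_system T) (FF : Filter F)
    (R : realType) (f : T -> \bar R) (l : R) :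
  (forall e, 0 < e -> \forall x \near F, ((l - e)%:E <= f x <= (l + e)%:E)%E) ->
  f x @[x --> F] --> l%:E.
Proof.
move=> fl; apply/fine_cvgP; split.
  apply: filterS (fl 1 ltr01) => x /andP[lf fl1].
  rewrite fin_numE gt_eqF ?(lt_le_trans _ lf) ?ltNyr//=.
  by rewrite lt_eqF// (le_lt_trans fl1)// ltry.
apply/cvgrPdist_le => e e0; apply: filterS (fl e e0) => x /=.
by case: (f x) => [r| |]; rewrite ?leye_eq ?leeNy_eq ?andbF//= !lee_fin ler_distlC.
Qed.

Lemma powRN_cvgy (R : realType) (c : R) : 0 < c -> x `^ (- c) @[x --> +oo] --> 0.
Proof.
move=> c0; apply/cvgrPdist_le => e e0.
near=> x; rewrite sub0r normrN ger0_norm ?powR_ge0//.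
have x0 : 0 < x by near: x; exact: nbhs_pinfty_gt.
have ex : e `^ (- c^-1) <= x by near: x; exact: nbhs_pinfty_ge.
have e1 : e = (e `^ (- c^-1)) `^ (- c).
  by rewrite -powRrM mulrNN mulVf ?gt_eqF// powRr1// ltW.
rewrite [leRHS]e1 [leLHS]powRN [leRHS]powRN lef_pV2 ?posrE ?powR_gt0//.
by apply: ge0_ler_powR; rewrite ?nnegrE ?powR_ge0 ?(ltW c0) ?(ltW x0).
Unshelve. all: by end_near.
Qed.

Lemma integral_powR_tail (R : realType) (c T : R) : 0 < c -> 0 < T ->
  (\int[lebesgue_measure]_(t in `[T, +oo[) (t `^ (- (1 + c)))%:E =
   (T `^ (- c) / c)%:E)%E.
Proof.
move=> c0 T0.
have pos x : T <= x -> 0 < x by exact: lt_le_trans.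
rewrite (@ge0_continuous_FTC2y _ _ (fun x => - (x `^ (- c) / c)) _ 0).
- by rewrite -EFinB opprK add0r.
- by move=> x _; exact: powR_ge0.
- apply: derivable_within_continuous => x; rewrite in_itv/= andbT => Tx.
  by apply: derivable_powR; rewrite in_itv/= andbT pos.
- rewrite -oppr0; apply: cvgN; rewrite -(mul0r c^-1); apply: cvgMl.
  exact: powRN_cvgy.
- move=> x Tx; apply: derivableN; apply: derivableM => //.
  by apply: derivable_powR; rewrite in_itv/= andbT pos// ltW.
- have cT : {for T, continuous (fun x : R => x `^ (- c))}.
    apply/differentiable_continuous/derivable1_diffP.
    by apply: derivable_powR; rewrite in_itv/= andbT.
  by apply: cvg_at_right_filter; apply: cvgN; apply: cvgMl; exact: cT.
- move=> x; rewrite in_itv/= andbT => Tx.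
  have x0 : 0 < x by rewrite pos// ltW.
  have d := is_derive1_powR (- c) x0.
  rewrite (_ : (fun x => _) = - (c^-1 *: (fun x => x `^ (- c)))); last first.
    by apply/funext => y; rewrite !fctE /= [_ *: _]mulrC.
  rewrite derive1E derive_val.
  rewrite -[_ *: _]/(_ * _) mulrA mulrN mulVf ?gt_eqF// mulN1r opprK.
  by rewrite opprD addrC.
Qed.

(* The splitting time [T] is at least 1 so that, for [t <= T] and small [s],
   the weight is at most [T `^ (s0 * q)] times the weight at the exponent [s0]. *)
Lemma abelian_limit (R : realType) (q L s0 : R) (E : R -> \bar R) :
  0 < q -> 0 <= L -> 0 < s0 ->
  (forall t, 0 < t -> (0 <= E t)%E) ->
  measurable_fun [set t : R | 0 < t] E ->
  (forall e, 0 < e -> exists M : R, 0 < M /\ forall t, M <= t ->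
     (E t <= (L + e)%:E)%E /\ (L%:E <= E t + e%:E)%E) ->
  (\int[lebesgue_measure]_(t in [set t : R | (0 < t)%R])
     ((t `^ (- (1 + s0 * q)))%:E * E t) < +oo)%E ->
  (s%:E * \int[lebesgue_measure]_(t in [set t : R | (0 < t)%R])
     ((t `^ (- (1 + s * q)))%:E * E t))%E @[s --> 0^'+] --> (L / q)%:E.
Proof.
move=> q0 L0 s00 E0 mE E_L int_s0.
set I := fun s => (\int[lebesgue_measure]_(t in [set t : R | (0 < t)%R])
  ((t `^ (- (1 + s * q)))%:E * E t))%E.
have I0 s : (0 <= I s)%E.
  by apply: integral_ge0 => t /= t0; rewrite mule_ge0 ?lee_fin ?powR_ge0 ?E0.
apply: cvge_fin_dist_le => e e0.
(* After multiplication by [s] the weight beyond [T] has mass at most [1 / q], so an error [e1] in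
   [E] costs at most [e / 2]. *)
pose e1 := e * q / 2.
have e10 : 0 < e1 by rewrite divr_gt0// mulr_gt0.
have [M [M0 E_M]] := E_L _ e10.
pose T := Num.max M 1.
have T1 : 1 <= T by rewrite le_max lexx orbT.
have T0 : 0 < T by exact: lt_le_trans T1.
have E_T t : T <= t -> (E t <= (L + e1)%:E)%E /\ (L%:E <= E t + e1%:E)%E.
  by move=> Tt; apply: E_M; apply: le_trans Tt; rewrite le_max lexx.
have D_split : [set t : R | 0 < t] = `]0, T[%classic `|` `[T, +oo[%classic.
  apply/seteqP; split => t /=; rewrite !in_itv/= ?andbT.
    by move=> t0; case: (ltP t T) => ?; [left; rewrite t0|right].
  by case=> [/andP[]//|]; exact: lt_le_trans.
have mD : measurable [set t : R | 0 < t].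
  by rewrite D_split; exact: measurableU.
have sub_small : `]0, T[%classic `<=` [set t : R | 0 < t].
  by move=> t /=; rewrite in_itv/= => /andP[].
have sub_large : `[T, +oo[%classic `<=` [set t : R | 0 < t].
  by move=> t /=; rewrite in_itv/= andbT; exact: lt_le_trans.
pose w s t := ((t `^ (- (1 + s * q)))%:E * E t)%E.
have w0 s t : 0 < t -> (0 <= w s t)%E.
  by move=> t0; rewrite mule_ge0 ?lee_fin ?powR_ge0 ?E0.
have mpow s (A : set R) : measurable_fun A (fun t : R => (t `^ (- (1 + s * q)))%:E).
  by apply/measurable_EFinP; apply: measurable_funTS; exact: measurable_powR.
have mw s : measurable_fun [set t : R | 0 < t] (w s).
  exact: emeasurable_funM.
have mw_small s : measurable_fun `]0, T[ (w s).
  by apply: measurable_funS (mw s).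
have mw_large s : measurable_fun `[T, +oo[ (w s).
  by apply: measurable_funS (mw s).
have I_split s : I s = (\int[lebesgue_measure]_(t in `]0%R, T[) w s t +
    \int[lebesgue_measure]_(t in `[T, +oo[) w s t)%E.
  rewrite /I -/(w s) D_split ge0_integral_setU//.
  - by rewrite -D_split; exact: mw.
  - by move=> t; rewrite -D_split; exact: w0.
  - rewrite disj_set2E; apply/eqP/seteqP; split => // t [/=].
    by rewrite !in_itv/= andbT => /andP[_ tT]; rewrite leNgt tT.
have large s : 0 < s -> (\int[lebesgue_measure]_(t in `[T, +oo[)
    (t `^ (- (1 + s * q)))%:E = (T `^ (- (s * q)) / (s * q))%:E)%E.
  by move=> s1; apply: integral_powR_tail => //; exact: mulr_gt0.
(* A bound on the integral over times before [T], uniform in [s <= s0]; the factor [s] therefore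
   kills this part. *)
pose c := T `^ (s0 * q) * fine (I s0).
have c0 : 0 <= c by rewrite mulr_ge0 ?powR_ge0 ?fine_ge0.
have Is0E : (fine (I s0))%:E = I s0 by rewrite fineK// ge0_fin_numE.
have small s : 0 < s -> s <= s0 ->
    (\int[lebesgue_measure]_(t in `]0%R, T[) w s t <= c%:E)%E.
  move=> s1 ss0; rewrite /c EFinM Is0E.
  apply: (@le_trans _ _ (\int[lebesgue_measure]_(t in `]0%R, T[)
      ((T `^ (s0 * q))%:E * w s0 t))%E).
    apply: ge0_le_integral => //.
    - by move=> t /sub_small; exact: w0.
    - exact: mw_small.
    - by apply: measurable_funeM; exact: mw_small.
    - move=> t /[dup] /sub_small /= t0; rewrite in_itv/= => /andP[_ tT].
      rewrite /w muleA -EFinM lee_wpmul2r ?E0// lee_fin.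
      rewrite (_ : - (1 + s * q) = (s0 - s) * q + - (1 + s0 * q)); last by ring.
      rewrite powRD; last by rewrite (gt_eqF t0) implybT.
      rewrite ler_wpM2r ?powR_ge0//.
      apply: (@le_trans _ _ (T `^ ((s0 - s) * q))).
        by apply: ge0_ler_powR;
          rewrite ?nnegrE ?mulr_ge0 ?subr_ge0//; exact: ltW.
      by rewrite ler_powR// ler_wpM2r ?(ltW q0)// lerBlDr lerDl ltW.
  rewrite ge0_integralZl ?lee_fin ?powR_ge0//; last 2 first.
  - exact: mw_small.
  - by move=> t /sub_small; exact: w0.
  rewrite lee_wpmul2l ?lee_fin ?powR_ge0//.
  apply: ge0_subset_integral => //; first exact: mw.
  by move=> t; exact: w0.
have lnT0 : 0 <= ln T by rewrite ln_ge0.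
have Ll0 : 0 <= L * ln T by rewrite mulr_ge0.
(* A quantitative form of the convergence of this power to 1: the lower bound is [1 + x <= expR x]
   at [x = - (s * q * ln T)]. *)
have TN s : 0 < s -> 1 - s * q * ln T <= T `^ (- (s * q)) <= 1.
  move=> s1; apply/andP; split.
    by rewrite /powR (gt_eqF T0) mulNr; exact: expR_ge1Dx.
  rewrite -[leRHS](powRr0 T) ler_powR// oppr_le0 mulr_ge0// ltW//.
have mul_s s r : 0 < s -> s * (r / (s * q)) = r / q.
  by move=> s1; field; rewrite !gt_eqF.
near=> s; rewrite -!/(I s).
have s1 : 0 < s by near: s; exact: nbhs_right_gt.
have ss0 : s <= s0 by near: s; exact: nbhs_right_le.
(* Besides the [e / 2] due to [e1], the upper bound spends [e / 2] on small times, and the lower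
   bound spends [e / 2] on the distance of the power of [T] from 1. *)
have sc : s * c <= e / 2.
  have : s <= e / 2 / (c + 1).
    by near: s; apply: nbhs_right_le; rewrite !divr_gt0// ltr_wpDl.
  rewrite ler_pdivlMr ?ltr_wpDl//; apply: le_trans.
  by rewrite ler_wpM2l ?(ltW s1)// lerDl.
have sL : s * (L * ln T) <= e / 2.
  have : s <= e / 2 / (L * ln T + 1).
    by near: s; apply: nbhs_right_le; rewrite !divr_gt0// ltr_wpDl.
  rewrite ler_pdivlMr ?ltr_wpDl//; apply: le_trans.
  by rewrite ler_wpM2l ?(ltW s1)// lerDl.
have [TN1 TN2] := andP (TN s s1).
have mpow_large := mpow s `[T, +oo[%classic.
have pow0 t : (0 <= (t `^ (- (1 + s * q)))%:E)%E by rewrite lee_fin powR_ge0.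
apply/andP; split; last first.
- have up : (\int[lebesgue_measure]_(t in `[T, +oo[) w s t <=
      ((L + e1) * (T `^ (- (s * q)) / (s * q)))%:E)%E.
    rewrite EFinM -large// -ge0_integralZl ?lee_fin ?addr_ge0 ?(ltW e10)//.
    apply: ge0_le_integral => //.
    + by move=> t /sub_large; exact: w0.
    + exact: mw_large.
    + exact: measurable_funeM.
    + move=> t /=; rewrite in_itv/= andbT => /E_T[? _].
      by rewrite /w muleC lee_wpmul2r.
  apply: (@le_trans _ _ (s%:E * (c%:E + ((L + e1) * (T `^ (- (s * q)) / (s * q)))%:E))%E).
    by rewrite lee_wpmul2l ?lee_fin ?(ltW s1)// I_split leeD// small.
  rewrite -EFinD -EFinM lee_fin mulrDr (mulrCA s (L + e1)) mul_s//.
  have : (L + e1) * (T `^ (- (s * q)) / q) <= L / q + e / 2.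
    rewrite mulrA ler_pdivrMr// (mulrDl (L / q)) divfK ?gt_eqF//.
    have -> : e / 2 * q = e1 by rewrite /e1; ring.
    by apply: ler_piMr => //; rewrite addr_ge0// ltW.
  lra.
(* For the lower bound the times before [T] are simply dropped; [e1] stays on the right so that
   everything remains nonnegative. *)
- have low : ((L * (T `^ (- (s * q)) / (s * q)))%:E <=
      \int[lebesgue_measure]_(t in `[T, +oo[) w s t +
      (e1 * (T `^ (- (s * q)) / (s * q)))%:E)%E.
    rewrite (EFinM L) (EFinM e1) -large// -!ge0_integralZl ?lee_fin ?(ltW e10)//.
    rewrite -ge0_integralD//; last 4 first.
    + by move=> t /sub_large; exact: w0.
    + exact: mw_large.
    + by move=> t _; rewrite mule_ge0// lee_fin ltW.
    + exact: measurable_funeM.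
    apply: ge0_le_integral => //.
    + by move=> t _; rewrite mule_ge0.
    + exact: measurable_funeM.
    + apply: emeasurable_funD; first exact: mw_large.
      exact: measurable_funeM.
    + move=> t /[dup] /sub_large /= t0; rewrite in_itv/= andbT => /E_T[_ ?].
      rewrite /w muleC [X in (_ + X)%E]muleC.
      by rewrite -ge0_muleDr ?lee_wpmul2l// ?E0 ?lee_fin ?(ltW e10).
  have Z0 : 0 <= T `^ (- (s * q)) / (s * q).
    by rewrite divr_ge0 ?powR_ge0// mulr_ge0// ltW.
  have sI : ((L * (T `^ (- (s * q)) / q))%:E <=
      s%:E * I s + (e1 * (T `^ (- (s * q)) / q))%:E)%E.
    rewrite -!(mul_s s)// !(mulrCA _ s) !(EFinM s).
    rewrite -ge0_muleDr ?I0 ?lee_fin ?(mulr_ge0 (ltW e10))//.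
    rewrite lee_wpmul2l ?lee_fin ?(ltW s1)//; apply: le_trans low _.
    rewrite leeD2r// I_split leeDr//.
    by apply: integral_ge0 => t /sub_small; exact: w0.
  have e1q : e1 * (T `^ (- (s * q)) / q) <= e / 2.
    rewrite mulrA ler_pdivrMr// (_ : e / 2 * q = e1); last by rewrite /e1; ring.
    by apply: ler_piMr => //; exact: ltW.
  have Lq : L / q - e / 2 <= L * (T `^ (- (s * q)) / q).
    rewrite mulrA ler_pdivlMr// (mulrBl _ (L / q)) divfK ?gt_eqF//.
    have := ler_wpM2l L0 TN1; have := ler_wpM2r (ltW q0) sL; lra.
  move: sI; case: (s%:E * I s)%E => [r| |]; rewrite ?leey// -?EFinD ?lee_fin//.
  by lra.
Unshelve. all: by end_near.
Qed.

(** * Densities, products and Lebesgue measure on tuples *)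

Section sigma_finite_copy.
Context d (T : measurableType d) (R : realType) (m : {measure set T -> \bar R}).
Hypothesis sm : sigma_finite setT m.

(** A synonym of [m] that carries the proof, so that a sigma-finite structure can be attached to a
    measure whose sigma-finiteness is a hypothesis. *)
Definition sigma_finite_copy of sigma_finite setT m : set T -> \bar R := m.

HB.instance Definition _ := isMeasure.Build _ _ _ (sigma_finite_copy sm)
  (measure0 m) (measure_ge0 m) (@measure_semi_sigma_additive _ _ _ m).

HB.instance Definition _ := Measure_isSigmaFinite.Build _ _ _
  (sigma_finite_copy sm) sm.

End sigma_finite_copy.

Section density.
Context d (T : measurableType d) (R : realType).
Variables (nu : {measure set T -> \bar R}) (w : T -> R).
Hypotheses (mw : measurable_fun setT w) (w0 : forall x, 0 <= w x).

Local Open Scope ereal_scope.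

(** The two proofs are arguments so that the measure structure can be declared on the resulting
    term. *)
Definition density of measurable_fun setT w & (forall x, (0 <= w x)%R) :=
  fun A : set T => \int[nu]_(x in A) (w x)%:E.

Local Notation dens := (density mw w0).

Let density0 : dens set0 = 0.
Proof. by rewrite /density integral_set0. Qed.

Let density_ge0 A : 0 <= dens A.
Proof. by apply: integral_ge0 => x _; rewrite lee_fin. Qed.

Let density_sigma_additive : semi_sigma_additive dens.
Proof.
move=> F mF tF mUF; rewrite /density ge0_integral_bigcup//.
- apply: is_cvg_ereal_nneg_natsum_cond => n _ _.
  by apply: integral_ge0 => x _; rewrite lee_fin.
- by apply: measurable_funTS; exact/measurable_EFinP.
- by move=> x _; rewrite lee_fin.
Qed.

HB.instance Definition _ := isMeasure.Build _ _ _ dens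
  density0 density_ge0 density_sigma_additive.

Import HBNNSimple.

Let integral_density_nnsfun (h : {nnsfun T >-> R}) :
  \int[dens]_x (h x)%:E = \int[nu]_x ((w x)%:E * (h x)%:E).
Proof.
have mh A r : measurable_fun A (fun x => (r * \1_(h @^-1` [set r]) x)%:E : \bar R).
  apply/measurable_EFinP.
  by apply: measurable_funM; [exact: measurable_cst|exact: measurable_indic].
have mwE : measurable_fun setT (fun x => (w x)%:E) by exact/measurable_EFinP.
rewrite integralT_nnsfun sintegralE.
transitivity (\int[nu]_x \sum_(r \in range h)
    ((w x)%:E * (r * \1_(h @^-1` [set r]) x)%:E)); last first.
  apply: eq_integral => x _.
  rewrite -ge0_mule_fsumr; last by move=> r; exact: nnfun_muleindic_ge0.
  by rewrite fsumEFin// -fimfunE.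
rewrite ge0_integral_fsum//; last 2 first.
- by move=> r; exact: emeasurable_funM.
- by move=> r x _; apply: mule_ge0; [rewrite lee_fin|exact: nnfun_muleindic_ge0].
apply: eq_fsbigr => r; rewrite inE => -[x _ <-].
under [RHS]eq_integral do rewrite EFinM muleCA.
rewrite ge0_integralZl//; last 3 first.
- apply: emeasurable_funM => //; apply/measurable_EFinP; exact: measurable_indic.
- by move=> y _; rewrite mule_ge0 ?lee_fin.
- by rewrite lee_fin.
congr (_ * _); rewrite /= /density integral_mkcond.
apply: eq_integral => y _; rewrite patchE indicE.
by case: (y \in _); rewrite ?mule1 ?mule0.
Qed.

(** Simple functions reduce to the definition on level sets; monotone convergence on both sides does
    the rest. *)
Lemma integral_density (g : T -> \bar R) : measurable_fun setT g ->
  (forall x, 0 <= g x) -> \int[dens]_x g x = \int[nu]_x ((w x)%:E * g x).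
Proof.
move=> mg g0; pose h := nnsfun_approx measurableT mg.
have hg x : (h n x)%:E @[n --> \oo] --> g x by exact: cvg_nnsfun_approx.
have mwE : measurable_fun setT (fun x => (w x)%:E) by exact/measurable_EFinP.
have hnd x a b : (a <= b)%N -> (h a x <= h b x)%R.
  by move=> ab; exact/lefP/nd_nnsfun_approx.
transitivity (limn (fun n => \int[dens]_x (h n x)%:E)).
  rewrite -monotone_convergence//.
  - by apply: eq_integral => x _; apply/esym/cvg_lim.
  - by move=> n; exact/measurable_EFinP.
  - by move=> n x _; rewrite lee_fin.
  - by move=> x _ a b ab; rewrite lee_fin hnd.
under eq_fun do rewrite integral_density_nnsfun.
rewrite -monotone_convergence//.
- apply: eq_integral => x _; apply/cvg_lim => //; exact: cvgeZl.
- by move=> n; apply: emeasurable_funM => //; exact/measurable_EFinP.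
- by move=> n x _; rewrite mule_ge0 ?lee_fin.
- by move=> x _ a b ab; rewrite lee_wpmul2l ?lee_fin ?hnd.
Qed.

End density.

Lemma sigma_finite_product d1 d2 (T1 : measurableType d1) (T2 : measurableType d2)
    (R : realType) (m1 : {sigma_finite_measure set T1 -> \bar R})
    (m2 : {sigma_finite_measure set T2 -> \bar R}) :
  sigma_finite setT (m1 \x m2)%E.
Proof.
have /sigma_finiteP[F [FT ndF finF]] := sigma_finiteT m1.
have /sigma_finiteP[G [GT ndG finG]] := sigma_finiteT m2.
exists (fun n => F n `*` G n); last first.
  move=> n; have [mF Fn] := finF n; have [mG Gn] := finG n.
  split; first exact: measurableX.
  by rewrite product_measure1E// lte_mul_pinfty// ge0_fin_numE.
apply/esym; rewrite -subTset => -[x y] _.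
have [i _ Fi] : (\bigcup_i F i) x by rewrite -FT.
have [j _ Gj] : (\bigcup_i G i) y by rewrite -GT.
(* Both exhaustions increase, so the index [i + j] serves both coordinates. *)
exists (i + j)%N => //; split => /=.
  by move: x Fi; apply/subsetPset/ndF; exact: leq_addr.
by move: y Gj; apply/subsetPset/ndG; exact: leq_addl.
Qed.

Section tuple_lebesgue.
Context (R : realType).
Local Open Scope ereal_scope.

Let tuple_cons n (z : measurableTypeR R * n.-tuple R) : n.+1.-tuple R :=
  [tuple of (z.1 : R) :: z.2].

Let measurable_tuple_cons n : measurable_fun setT (@tuple_cons n).
Proof.
apply: measurable_cons; last exact: measurable_snd.
exact: measurable_fst.
Qed.

Let measurable_tuple_slice n (x : R) :
  measurable_fun setT (fun t : n.-tuple R => [tuple of x :: t]).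
Proof. exact: measurable_cons. Qed.

Let tuple_uncons n (x : n.+1.-tuple R) : measurableTypeR R * n.-tuple R :=
  (thead x, [tuple of behead x]).

Let tuple_consK n : cancel (@tuple_cons n) (@tuple_uncons n).
Proof.
move=> -[x t]; rewrite /tuple_uncons /= theadE; congr (_, _).
exact/val_inj.
Qed.

Let measurable_tuple_uncons n : measurable_fun setT (@tuple_uncons n).
Proof.
apply/measurable_fun_pairP; split; last exact: measurable_behead.
exact: measurable_tnth.
Qed.

(** Links the recursive integral to measure theory: the measure is a Dirac mass in dimension 0, and
    then the image under consing of Lebesgue measure times the previous measure, with Tonelli giving
    the iterated integral. *)
Lemma leb_int_measure n : exists nu : {sigma_finite_measure set (n.-tuple R) -> \bar R},
  forall g : n.-tuple R -> \bar R, measurable_fun setT g -> (forall x, 0 <= g x) ->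
  leb_int g = \int[nu]_x g x.
Proof.
elim: n => [|n [nu nuE]].
  exists (dirac [tuple]) => g mg g0.
  by rewrite integral_dirac// diracT mul1e.
pose lam : {sigma_finite_measure set (measurableTypeR R) -> \bar R} :=
  @lebesgue_measure R.
(* The canonical measure structure of [pushforward] does not infer the
   measurability of the map, so the instance is applied explicitly. *)
pose m : {measure set (n.+1.-tuple R) -> \bar R} :=
  measure_function_pushforward__canonical__measure_function_Measure
    (lam \x nu) (@measurable_tuple_cons n).
have sm : sigma_finite setT m.
  (* The exhaustion of the product is carried over through the measurable inverse of consing. *)
  have [F FT F_fin] := sigma_finite_product lam nu.
  exists (fun i => @tuple_uncons n @^-1` F i).
    by rewrite -preimage_bigcup -FT preimage_setT.
  move=> i; have [mF F_lt] := F_fin i; split.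
    by rewrite -[X in measurable X]setTI; exact: measurable_tuple_uncons.
  apply: le_lt_trans F_lt; rewrite le_eqVlt; apply/orP; left; apply/eqP.
  rewrite /m /= /pushforward; congr (_ _); apply/funext => z.
  by rewrite /preimage/= tuple_consK.
exists (sigma_finite_copy sm) => g mg g0.
have g0T : {in setT, forall x, 0 <= g x} by move=> x _.
apply/esym; apply: etrans (ge0_integral_pushforward (@measurable_tuple_cons n)
  (lam \x nu) measurableT mg g0T) _.
have mgc := measurableT_comp mg (@measurable_tuple_cons n).
have gc0 z : 0 <= (g \o @tuple_cons n) z by exact: g0.
rewrite preimage_setT (fubini_tonelli1 _ mgc gc0).
apply: eq_integral => x _; apply/esym/nuE => //.
exact: (measurableT_comp mg (measurable_tuple_slice x)).
Qed.

Lemma measurable_leb_int_cons n (g : n.+1.-tuple R -> \bar R) :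
  measurable_fun setT g -> (forall x, 0 <= g x) ->
  measurable_fun setT
    (fun x : measurableTypeR R => leb_int (fun t : n.-tuple R => g [tuple of x :: t])).
Proof.
move=> mg g0; have [nu nuE] := leb_int_measure n.
rewrite (_ : (fun _ => _) = fun x => \int[nu]_t (g \o @tuple_cons n) (x, t)).
  have mgc := measurableT_comp mg (@measurable_tuple_cons n).
  have gc0 z : 0 <= (g \o @tuple_cons n) z by exact: g0.
  exact: (measurable_fun_fubini_tonelli_F _ mgc gc0).
apply/funext => x; apply: nuE => //.
exact: (measurableT_comp mg (measurable_tuple_slice x)).
Qed.

Lemma leb_int_ge0 n (g : n.-tuple R -> \bar R) :
  (forall x, 0 <= g x) -> 0 <= leb_int g.
Proof. by elim: n g => [|n IH] g g0 //=; apply: integral_ge0 => x _; exact: IH. Qed.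

(** The volume of a cube on which [g >= 1], computed by peeling off one coordinate at a time. *)
Lemma leb_int_box_ge n (g : n.-tuple R -> \bar R) (c : n.-tuple R) (h : R) :
  measurable_fun setT g -> (forall x, 0 <= g x) -> (0 <= h)%R ->
  (forall x, (forall i, (tnth c i <= tnth x i <= tnth c i + h)%R) -> 1 <= g x) ->
  (h ^+ n)%:E <= leb_int g.
Proof.
move=> mg g0 h0; elim: n g c mg g0 => [|n IH] g c mg g0 gbox /=.
  by rewrite expr0; apply: gbox => -[].
have mI : measurable (`[thead c, (thead c + h)%R]%classic : set (measurableTypeR R)).
  exact: measurable_itv.
apply: (@le_trans _ _ (\int[lebesgue_measure]_(x in `[thead c, (thead c + h)%R])
    (h ^+ n)%:E)).
  rewrite integral_cst//= lebesgue_measure_itv/= lte_fin ltrDl.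
  case: ifPn => [_|h_le0]; first by rewrite -EFinB -EFinM lee_fin exprSr; lra.
  (* The degenerate interval has length 0, and so does the cube. *)
  have -> : h = 0%R by lra.
  by rewrite expr0n /= mule0.
apply: (@le_trans _ _ (\int[lebesgue_measure]_(x in `[thead c, (thead c + h)%R])
    leb_int (fun t : n.-tuple R => g [tuple of x :: t]))).
  apply: ge0_le_integral => //.
  - by move=> x _; rewrite lee_fin exprn_ge0.
  - by apply: measurable_funTS; exact: measurable_leb_int_cons.
  - move=> x /= xI; apply: (IH _ [tuple of behead c]) => //.
    + exact: (measurableT_comp mg (measurable_tuple_slice x)).
    + move=> t tc; apply: gbox => i.
      case: (unliftP ord0 i) => [j|] ->; last first.
        by rewrite tnth0; move: xI; rewrite in_itv.
      by rewrite [c]tuple_eta !tnthS.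
apply: ge0_subset_integral => //.
- exact: measurable_leb_int_cons.
- by move=> x _; exact: leb_int_ge0.
Qed.

End tuple_lebesgue.

(** * The limit theorem for general Markov kernels *)

Lemma measurable_kernel_form d (T : measurableType d) (R : realType)
    (mu : {sigma_finite_measure set T -> \bar R}) (k : R -> T -> T -> R)
    (G : T * T -> \bar R) :
  markov_kernel mu k -> measurable_fun setT G -> (forall z, 0 <= G z)%E ->
  measurable_fun [set t : R | 0 < t] (fun t => kernel_form mu k t G).
Proof.
move=> markov_k mG G0.
pose P := [set u : R * (T * T) | 0 < u.1].
pose kE (u : R * (T * T)) := (k u.1 u.2.1 u.2.2)%:E.
have mt : measurable [set t : R | 0 < t].
  rewrite [X in measurable X](_ : _ = `]0, +oo[%classic).
    exact: measurable_itv.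
  by apply/seteqP; split => t /=; rewrite in_itv/= andbT.
have mP : measurable P.
  rewrite [X in measurable X](_ : _ = [set t : R | 0 < t] `*` setT).
    exact: measurableX.
  by apply/seteqP; split => -[t z] //= [].
(* The kernel is measurable on positive times only, so it is extended by 0. *)
have mk : measurable_fun setT (kE \_ P).
  apply/(measurable_restrictT _ mP)/measurable_EFinP.
  exact: kernel_measurable markov_k.
have k0 u : (0 <= (kE \_ P) u)%E.
  by apply: erestrict_ge0 => v v0; exact: (kernel_ge0 markov_k).
(* Regrouping as [((t, x), y)] lets Tonelli integrate out [y], then [x], and leaves a measurable
   function of [t]. *)
pose reassoc (u : (R * T) * T) := (u.1.1, (u.1.2, u.2)).
have mr : measurable_fun setT reassoc.
  apply/measurable_fun_pairP; split.
    exact: (measurableT_comp measurable_fst measurable_fst).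
  apply/measurable_fun_pairP; split; last exact: measurable_snd.
  exact: (measurableT_comp measurable_snd measurable_fst).
have mr2 : measurable_fun setT (fun u : (R * T) * T => (u.1.2, u.2)).
  exact: (measurableT_comp measurable_snd mr).
pose H u := (G (u.1.2, u.2) * (kE \_ P) (reassoc u))%E.
have mH : measurable_fun setT H.
  apply: emeasurable_funM; first exact: (measurableT_comp mG mr2).
  exact: (measurableT_comp mk mr).
have H0 u : (0 <= H u)%E by rewrite mule_ge0.
have mH1 := measurable_fun_fubini_tonelli_F (m2 := mu) H mH H0.
have H10 v : (0 <= fubini_F mu H v)%E by apply: integral_ge0 => y _.
have mH2 := measurable_fun_fubini_tonelli_F (m2 := mu) _ mH1 H10.
apply: (eq_measurable_fun (fubini_F mu (fubini_F mu H))); last first.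
  exact: measurable_funTS.
move=> t /set_mem t0; rewrite (kernel_formE markov_k t0 mG G0).
apply: eq_integral => x _; apply: eq_integral => y _; congr (_ * _)%E.
by rewrite patchE mem_set.
Qed.

(** The abelian limit with [q = p / 2] and [L] twice the integral of the power of [|f|]; the
    quotient [L / q] produces the constant [4 / p]. *)
Lemma markov_besov_limit d (T : measurableType d) (R : realType)
    (mu : {sigma_finite_measure set T -> \bar R}) (k : R -> T -> T -> R)
    (p s0 : R) (f : T -> R) :
  markov_kernel mu k -> mu setT = +oo%E -> 0 < p -> 0 < s0 ->
  measurable_fun setT f -> (\int[mu]_x (`|f x| `^ p)%:E < +oo)%E ->
  let N s := (\int[lebesgue_measure]_(t in [set t : R | (0 < t)%R])
    ((t `^ (- (1 + s * p / 2)))%:E *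
     \int[mu]_x \int[mu]_y (`|f y - f x| `^ p * k t x y)%:E))%E in
  (N s0 < +oo)%E ->
  (s%:E * N s)%E @[s --> 0^'+] --> ((4 / p)%:E * \int[mu]_x (`|f x| `^ p)%:E)%E.
Proof.
move=> markov_k muT p0 s00 mf f_Lp N Ns0.
pose G (z : T * T) := ((`|f z.2 - f z.1| `^ p)%:E : \bar R).
have mG : measurable_fun setT G.
  apply/measurable_EFinP; apply: (measurableT_comp (measurable_powR p)).
  apply: measurableT_comp => //.
  by apply: measurable_funB; exact: measurableT_comp.
have G0 z : (0 <= G z)%E by rewrite lee_fin powR_ge0.
have NE s : N s = (\int[lebesgue_measure]_(t in [set t : R | (0 < t)%R])
    ((t `^ (- (1 + s * (p / 2))))%:E * kernel_form mu k t G))%E.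
  apply: eq_integral => t; rewrite inE /= => t0.
  rewrite (kernel_formE markov_k)// mulrA; congr (_ * _)%E.
set F := (\int[mu]_x (`|f x| `^ p)%:E)%E.
have F0 : (0 <= F)%E by apply: integral_ge0 => x _; rewrite lee_fin powR_ge0.
have FE : F = (fine F)%:E by rewrite fineK// ge0_fin_numE.
have -> : ((4 / p)%:E * F)%E = (2 * fine F / (p / 2))%:E.
  rewrite [in LHS]FE -EFinM; congr EFin; field; exact: lt0r_neq0.
under eq_fun do rewrite NE.
have q0 : 0 < p / 2 by rewrite divr_gt0.
have L0 : 0 <= 2 * fine F by rewrite mulr_ge0// fine_ge0.
have E0 t : 0 < t -> (0 <= kernel_form mu k t G)%E.
  by move=> t0; exact: (kernel_form_ge0 markov_k).
have mE := measurable_kernel_form markov_k mG G0.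
rewrite NE in Ns0.
exact: (abelian_limit q0 L0 s00 E0 mE
  (kernel_increment_cvg markov_k muT p0 mf f_Lp) Ns0).
Qed.

(** * The Dunkl measure: sigma-finiteness and infinite total mass *)

Section dunkl_weight.
Context (R : realType) (n : nat) (rs : seq (n.-tuple R)) (beta : n.-tuple R).
Variable kappa : n.-tuple R -> R.

Let w := wk rs beta kappa.

Let w0 x : 0 <= w x.
Proof. by apply: prodr_ge0 => a _; exact: powR_ge0. Qed.

Let mw : measurable_fun setT w.
Proof.
apply: measurable_prod => a _.
apply: (measurableT_comp (measurable_powR _)); apply: measurableT_comp => //.
apply: measurable_sum => i; apply: measurable_funM => //.
exact: measurable_tnth.
Qed.

(** The measure has density [w]. Since [w] may be unbounded, an exhaustion for Lebesgue measure is
    intersected with the sets [w <= N], where the mass is at most [N] times a finite one. *)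
Lemma muk_int_measure : exists mu : {sigma_finite_measure set (n.-tuple R) -> \bar R},
  forall g : n.-tuple R -> \bar R, measurable_fun setT g -> (forall x, 0 <= g x)%E ->
  muk_int rs beta kappa g = (\int[mu]_x g x)%E.
Proof.
have [nu nuE] := leb_int_measure R n.
have mwE : measurable_fun setT (EFin \o w) by exact/measurable_EFinP.
have sigma_w : sigma_finite setT (density nu mw w0).
  have /sigma_finiteP[F [FT ndF finF]] := sigma_finiteT nu.
  pose W N := w @^-1` `]-oo, N%:R]%classic.
  have mW N : measurable (W N).
    by rewrite -[W N]setTI; apply: mw.
  exists (fun N => F N `&` W N); last first.
    move=> N; have [mF F_lt] := finF N; have mFW := measurableI _ _ mF (mW N).
    split => //; rewrite /density.
    apply: (@le_lt_trans _ _ (\int[nu]_(x in F N `&` W N) N%:R%:E)%E).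
      apply: ge0_le_integral => //.
      - by move=> x _; rewrite lee_fin.
      - exact: measurable_funTS.
      - by move=> x [_]; rewrite /W /= in_itv/= lee_fin.
    rewrite integral_cst//; apply: lte_mul_pinfty => //.
    by apply: le_lt_trans F_lt; apply: le_measure; rewrite ?inE//; exact: subIsetl.
  apply/esym; rewrite -subTset => x _.
  have [i _ Fi] : (\bigcup_i F i) x by rewrite -FT.
  have [j wj] : exists j, w x <= j%:R.
    by exists (Num.truncn (w x)).+1; rewrite ltW// truncnS_gt.
  exists (i + j)%N => //; split => /=.
    by move: x Fi {wj}; apply/subsetPset/ndF; exact: leq_addr.
  by rewrite /W /= in_itv/= (le_trans wj)// ler_nat leq_addl.
exists (sigma_finite_copy sigma_w) => g mg g0.
rewrite [RHS](integral_density nu mw w0 mg g0); apply: nuE.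
  exact: emeasurable_funM.
by move=> x; rewrite mule_ge0 ?lee_fin.
Qed.

Hypotheses (rs_root : root_system rs) (kappa_mult : multiplicity rs kappa).

(** In dimension 0 the only vector is zero, which is no root. Positive dimension is what makes the
    volumes of growing cubes unbounded. *)
Lemma root_system_dim_gt0 : (0 < n)%N.
Proof.
case: rs_root => -[rs0 _] rs_neq0 _ _ _.
case: rs rs0 rs_neq0 => [//|a s] _ /(_ a); rewrite mem_head => /(_ isT).
case: n a => [a a0|//]; exfalso; apply: a0.
by rewrite (tuple0 a) (tuple0 vzero).
Qed.

(* The weight is at least 1 on the cubes [K beta + [0, d K]^n], [K] large, which
   lie deep in the Weyl chamber of [beta]. *)
Lemma muk_int_infinite : muk_int rs beta kappa (fun=> 1%E) = +oo%E.
Proof.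
(* Moving within a cube of side [d * K] changes the product with [a] by at most [d * K * (B a - 1)];
   the extra 1 in [B] leaves a margin of [d * K >= 1]. *)
pose B (a : n.-tuple R) := 1 + \sum_(i < n) `|tnth a i|.
have B0 a : 0 < B a by rewrite ltr_wpDr// sumr_ge0.
have [d d0 dB] : exists2 d : R, 0 < d &
    forall a, a \in pos_roots rs beta -> d * B a <= vdot beta a.
  have : forall a, a \in pos_roots rs beta -> 0 < vdot beta a.
    by move=> a; rewrite mem_filter => /andP[].
  elim: (pos_roots rs beta) => [_|a s IH pos]; first by exists 1.
  have [|d d0 dB] := IH; first by move=> b bs; apply: pos; rewrite inE bs orbT.
  have a0 : 0 < vdot beta a by apply: pos; rewrite mem_head.
  exists (Num.min d (vdot beta a / B a)).
    by rewrite lt_min d0 divr_gt0.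
  move=> b; rewrite inE => /predU1P[->|/dB].
    by rewrite -ler_pdivlMr// ge_min lexx orbT.
  by apply: le_trans; rewrite ler_pM2r// ge_min lexx.
have n0 := root_system_dim_gt0.
have w1 K x : 1 / d <= K ->
    (forall i, K * tnth beta i <= tnth x i <= K * tnth beta i + d * K) -> 1 <= w x.
  move=> Kd xK; rewrite /w /wk.
  have K0 : 0 < K by apply: lt_le_trans Kd; rewrite divr_gt0.
  have dK1 : 1 <= d * K by rewrite mulrC -ler_pdivrMr.
  rewrite big_seq; apply: (big_ind (fun y => 1 <= y)) => //.
    by move=> y z y1 z1; rewrite -[1]mulr1 ler_pM.
  move=> a a_pos.
  have : 1 <= vdot a x.
    have dist : K * vdot beta a - d * K * (B a - 1) <= vdot a x.
      rewrite /B addrAC subrr add0r lerBlDr /vdot !mulr_sumr -big_split/=.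
      apply: ler_sum => i _; have /andP[lo hi] := xK i.
      have : - (`|tnth a i| * (d * K)) <= tnth a i * (tnth x i - K * tnth beta i).
        rewrite lerNl -mulrN; apply: le_trans (ler_norm _) _.
        rewrite normrM ler_wpM2l// normrN ger0_norm ?subr_ge0//.
        by rewrite lerBlDl.
      lra.
    have := ler_wpM2l (ltW K0) (dB a a_pos); lra.
  move=> ax1; rewrite -[leLHS](powRr0 `|vdot a x|) ler_powR//.
    by rewrite (le_trans ax1)// ler_norm.
  rewrite mulr_ge0//; case: kappa_mult => + _; apply.
  by move: a_pos; rewrite mem_filter => /andP[].
apply/eqyP => M M0.
(* The cube then has side [Num.max 1 M], whose [n]-th power is at least [M] since [n > 0]. *)
pose K := Num.max 1 M / d.
have dK : d * K = Num.max 1 M by rewrite /K mulrC divfK ?gt_eqF.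
apply: (@le_trans _ _ ((d * K) ^+ n)%:E).
  rewrite dK lee_fin; apply: (@le_trans _ _ (Num.max 1 M)).
    by rewrite le_max lexx orbT.
  by rewrite ler_eXnr// le_max lexx.
apply: (leb_int_box_ge (c := [tuple K * tnth beta i | i < n])).
- by under eq_fun do rewrite mule1; exact/measurable_EFinP.
- by move=> x; rewrite mule1 lee_fin.
- by rewrite dK le_max ler01.
- move=> x xbox; rewrite mule1 lee_fin (w1 K)//.
    by rewrite ler_pM2r ?invr_gt0// le_max lexx.
  by move=> i; have := xbox i; rewrite tnth_mktuple.
Qed.

End dunkl_weight.

(** * Application to the Dunkl heat kernel *)

Unset Implicit Arguments.

Theorem theorem1p2 (R : realType) (n : nat) (rs : seq (n.-tuple R))
    (beta : n.-tuple R) (kappa : n.-tuple R -> R)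
    (hk : R -> n.-tuple R -> n.-tuple R -> R) (p : R) (f : n.-tuple R -> R) :
  root_system rs ->
  regular_vector rs beta ->
  multiplicity rs kappa ->
  dunkl_heat_kernel rs beta kappa hk ->
  1 <= p ->
  (exists s : R, 0 < s < 1 /\ in_besov rs beta kappa hk s p f) ->
  ((s%:E * besov_Np rs beta kappa hk s p f)%E @[s --> 0^'+]
     --> ((4 / p)%:E * muk_int rs beta kappa (fun x => (`|f x| `^ p)%:E))%E).
Proof.
move=> rs_root _ kappa_mult [[mhk hk_gt0] hk_sym [hk_cons hk_CK] _ _] p1.
move=> [s0 [/andP[s00 _] [[mf f_Lp] Ns0]]].
have p0 : 0 < p by exact: lt_le_trans p1.
have [mu muE] := muk_int_measure rs beta kappa.
have mhkt t : 0 < t -> measurable_fun setT (fun z => (hk t z.1 z.2)%:E : \bar R).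
  by move=> t0; apply/measurable_EFinP; exact: measurable_time_slice mhk t0.
have mhkx t x : 0 < t -> measurable_fun setT (fun y => (hk t x y)%:E : \bar R).
  move=> t0; exact: (measurableT_comp (mhkt t t0) (measurable_pair1 x)).
have hk0 t x y : 0 < t -> (0 <= (hk t x y)%:E)%E.
  by move=> t0; rewrite lee_fin ltW// hk_gt0.
(* The kernel axioms are stated with iterated integrals; [muE] turns them into integrals against
   [mu], once the integrands are known to be measurable and nonnegative. *)
have markov_hk : markov_kernel mu hk.
  split => //.
  - move=> t x t0; rewrite -muE; [exact: hk_cons|exact: mhkx|].
    by move=> y; exact: hk0.
  - move=> t s x y t0 s1; rewrite -muE; first exact: hk_CK.
    + under eq_fun do rewrite EFinM hk_sym//.
      apply: emeasurable_funM.
        by under eq_fun do rewrite hk_sym//; exact: mhkx.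
      by under eq_fun do rewrite hk_sym//; exact: mhkx.
    + by move=> z; rewrite lee_fin mulr_ge0// ltW// hk_gt0.
have mu_infty : mu setT = +oo%E.
  have -> : mu setT = (\int[mu]_x (fun=> 1) x)%E by rewrite integral_cst// mul1e.
  rewrite -muE//; exact: muk_int_infinite.
have mfp : measurable_fun setT (fun x => (`|f x| `^ p)%:E : \bar R).
  apply/measurable_EFinP; apply: (measurableT_comp (measurable_powR p)).
  exact: measurableT_comp.
have fp0 x : (0 <= (`|f x| `^ p)%:E)%E by rewrite lee_fin powR_ge0.
pose G t (z : n.-tuple R * n.-tuple R) :=
  (`|f z.2 - f z.1| `^ p * hk t z.1 z.2)%:E : \bar R.
have mG t : 0 < t -> measurable_fun setT (G t).
  move=> t0; apply/measurable_EFinP; apply: measurable_funM.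
    apply: (measurableT_comp (measurable_powR p)); apply: measurableT_comp => //.
    by apply: measurable_funB; exact: measurableT_comp.
  exact: measurable_time_slice mhk t0.
have G0 t z : 0 < t -> (0 <= G t z)%E.
  by move=> t0; rewrite lee_fin mulr_ge0 ?powR_ge0// ltW// hk_gt0.
(* The nested integrals are converted from the inside out: the outer conversion needs measurability
   of the inner integral in [x], which Tonelli supplies. *)
have NE s : besov_Np rs beta kappa hk s p f =
    (\int[lebesgue_measure]_(t in [set t : R | (0 < t)%R])
      ((t `^ (- (1 + s * p / 2)))%:E *
       \int[mu]_x \int[mu]_y (`|f y - f x| `^ p * hk t x y)%:E))%E.
  apply: eq_integral => t /set_mem t0; congr (_ * _)%E.
  have inner x : muk_int rs beta kappa
      (fun y => (`|f y - f x| `^ p * hk t x y)%:E) = (\int[mu]_y G t (x, y))%E.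
    apply: muE => [|y]; last exact: (G0 t (x, y)).
    exact: (measurableT_comp (mG t t0) (measurable_pair1 x)).
  under eq_fun do rewrite inner.
  apply: muE => [|x]; last by apply: integral_ge0 => y _; exact: G0.
  by apply: (measurable_fun_fubini_tonelli_F _ (mG t t0)) => z; exact: G0.
under eq_fun do rewrite NE.
rewrite (muE _ mfp fp0); rewrite (muE _ mfp fp0) in f_Lp; rewrite NE in Ns0.
exact: (markov_besov_limit markov_hk mu_infty p0 s00 mf f_Lp Ns0).
Qed.
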